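(* Let $p(\cdot)\in\mathcal{P}(\mathbb{R}^d)$ and let $\alpha,q$ be constants with $p(\cdot)\le\alpha\le q\le\infty$ and $\alpha<\infty$. Then the set $\left(L^{p(\cdot)},\ell^{q}\right)^{\alpha}_{\rm a}$ of all elements of $\left(L^{p(\cdot)},\ell^{q}\right)^{\alpha}$ of absolutely continuous norm is the closure of $\mathcal{C}_{\rm c}^{\infty}$ (and therefore the closure of $L^{\alpha}$) in $\left(L^{p(\cdot)},\ell^{q}\right)^{\alpha}$.
   Context: $L^0$ is the set of (a.e.-equivalence classes of) measurable complex-valued functions on $\mathbb{R}^d$. $\mathcal{P}(\mathbb{R}^d)$ is the set of measurable $p(\cdot):\mathbb{R}^d\to[1,\infty]$ with $1<p_-\le p(\cdot)\le p_+<\infty$, where $p_-$ and $p_+$ are the essential infimum and supremum of $p(\cdot)$. $\|f\|_{p(\cdot)}=\inf\{\lambda>0:\int_{\mathbb{R}^d}(|f(x)|/\lambda)^{p(x)}dx\le1\}$; $L^{p(\cdot)}$ is the set of measurable $f$ with $\|f\|_{p(\cdot)}<\infty$; $L^{p(\cdot)}_{\rm loc}$ is the set of measurable $f$ with $f\chi_K\in L^{p(\cdot)}$ for every compact $K$. For $k\in\mathbb{Z}^d$, $r>0$, $I_k^r=\prod_{j=1}^d[rk_j,r(k_j+1))$. $\|f\|_{p(\cdot),q}=\big\|\{\|f\chi_{I_k^1}\|_{p(\cdot)}\}_{k\in\mathbb{Z}^d}\big\|_{\ell^q}$. For $\rho>0$, $St_\rho^{(\alpha)}f(x)=\rho^{-d/\alpha}f(\rho^{-1}x)$.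 The Fofana space is $\left(L^{p(\cdot)},\ell^{q}\right)^{\alpha}=\{f\in L^{p(\cdot)}_{\rm loc}:\|f\|_{p(\cdot),q,\alpha}<\infty\}$ with norm $\|f\|_{p(\cdot),q,\alpha}=\sup_{\rho>0}\|St_\rho^{(\alpha)}f\|_{p(\cdot),q}$. An element $f$ of $X=\left(L^{p(\cdot)},\ell^{q}\right)^{\alpha}$ is of absolutely continuous norm if $\lim_n\|f_n\|_X=0$ for every sequence $(f_n)_{n\ge1}$ in $X$ with $|f|\ge f_n\ge f_{n+1}$ a.e. for all $n$ and $\lim_n f_n=0$ a.e. $\mathcal{C}_{\rm c}^{\infty}$ is the set of infinitely differentiable compactly supported functions on $\mathbb{R}^d$; $L^\alpha$ is the usual Lebesgue space on $\mathbb{R}^d$. *)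

(* Defs.v *)
From HB Require Import structures.
From mathcomp Require Import all_boot all_order all_algebra.
From mathcomp Require Import all_classical all_reals all_analysis.
From mathcomp Require Import measurable_realfun ess_sup_inf complex.

Set Implicit Arguments.
Unset Strict Implicit.
Unset Printing Implicit Defensive.

Import Order.TTheory GRing.Theory Num.Theory.
Import numFieldNormedType.Exports.

Local Open Scope classical_set_scope.
Local Open Scope ring_scope.
Local Open Scope complex_scope.

(* Throughout, the dimension of the Euclidean space is d.+1, so that it ranges
   over all positive integers. *)

Section LebesgueMeasure.
Context {R : realType} (d : nat).
Local Notation V := 'rV[R]_d.+1.

Definition box (ab : V * V) : set V :=
  [set x | forall i, ab.1 ord0 i <= x ord0 i < ab.2 ord0 i].

Definition box_volume (ab : V * V) : R :=
  \prod_i (ab.2 ord0 i - ab.1 ord0 i).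

Local Notation vol := (EFin \o box_volume).

Definition box_cover (X : set V) : set (nat -> V * V) :=
  [set B : nat -> V * V |
    (forall k i, (B k).1 ord0 i <= (B k).2 ord0 i) /\
    X `<=` \bigcup_k box (B k)].

Definition lebesgue_outer (X : set V) : \bar R :=
  ereal_inf ((fun B : nat -> V * V =>
    \sum_(k <oo) (box_volume (B k))%:E)%E @` box_cover X).

Lemma box_volume_ge0 (X : set V) (B : nat -> V * V) :
  box_cover X B -> forall k, (0 <= vol (B k))%E.
Proof.
move=> [leB _] k; rewrite lee_fin; apply: prodr_ge0 => i _.
by rewrite subr_ge0.
Qed.

Lemma lebesgue_outer_ge0 (X : set V) : (0 <= lebesgue_outer X)%E.
Proof.
apply: le_ereal_inf_tmp => _ [B BX <-].
by apply: nneseries_ge0 => k _ _; exact: (box_volume_ge0 BX).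
Qed.

Lemma lebesgue_outer0 : lebesgue_outer set0 = 0%E.
Proof.
apply/eqP; rewrite eq_le lebesgue_outer_ge0 andbT.
apply: ereal_inf_lbound; exists (fun=> (0, 0)); first by split.
rewrite eseries0// => k _ _ /=; rewrite /box_volume.
by rewrite (bigD1 ord0)//= subrr mul0r.
Qed.

Lemma lebesgue_outer_le (X Y : set V) :
  X `<=` Y -> (lebesgue_outer X <= lebesgue_outer Y)%E.
Proof.
move=> XY; apply: ereal_inf_le_tmp => _ [B [leB YB] <-].
by exists B => //; split => //; exact: subset_trans YB.
Qed.

Lemma lebesgue_outer_sigma_subadditive : sigma_subadditive lebesgue_outer.
Proof.
move=> A; have [[i ioo]|] := pselect (exists i, lebesgue_outer (A i) = +oo%E).
  rewrite (eseries_pinfty _ _ ioo) ?leey// => n _.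
  by rewrite -ltNye (lt_le_trans _ (lebesgue_outer_ge0 _)).
rewrite -forallNE => Aoo.
apply/lee_addgt0Pr => _/posnumP[e].
apply: le_trans (epsilon_trick _ (fun n => lebesgue_outer_ge0 (A n)) _) => //.
pose P n (B : nat -> V * V) := box_cover (A n) B /\
  (\sum_(k <oo) vol (B k) <=
     lebesgue_outer (A n) + (e%:num / (2 ^ n.+1)%:R)%:E)%E.
have [G PG] : {G : nat -> nat -> V * V & forall n, P n (G n)}.
  apply: (@choice _ _ P) => n; rewrite /P /lebesgue_outer.
  set S := (X in ereal_inf X); move infS : (ereal_inf S) => iS.
  case: iS infS => [r Sr|Soo|Soo].
  - have en1 : 0 < e%:num / (2 ^ n.+1)%:R by [].
    have /(lb_ereal_inf_adherent en1) : ereal_inf S \is a fin_num by rewrite Sr.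
    move=> [x [B BA muBx] xS].
    by exists B; split => //; rewrite muBx -Sr; exact/ltW.
  - by have := Aoo n; rewrite /lebesgue_outer Soo.
  - have := lebesgue_outer_ge0 (A n).
    by rewrite /lebesgue_outer -/S Soo.
have G_ge0 x : (0 <= (vol \o uncurry G) x)%E.
  by case: x => n m; exact: (box_volume_ge0 (PG n).1 m).
apply: (@le_trans _ _ (\esum_(i in setT) (vol \o uncurry G) i)).
  apply: ereal_inf_lbound => /=.
  have /card_esym/ppcard_eqP[f] := card_nat2.
  exists (uncurry G \o f).
    split => [k i|]; first by rewrite /=; case: (f k) => n m; exact: (PG n).1.1.
    move=> t [i _] /((PG i).1.2)[j _ Bijt].
    by exists (f^-1%FUN (i, j)) => //=; rewrite invK ?inE.
  rewrite -(esum_pred_image (vol \o uncurry G) _ xpredT) ?[fun=> _]set_true//.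
  by rewrite image_eq.
rewrite (_ : esum _ _ = \sum_(i <oo) \sum_(j <oo) vol (G i j))%E; last first.
  pose J : nat -> set (nat * nat) := fun i => [set (i, j) | j in setT].
  rewrite (_ : setT = \bigcup_k J k); last first.
    by rewrite predeqE => -[a b]; split => // _; exists a => //; exists b.
  rewrite esum_bigcupT /=; last 2 first.
    - apply/trivIsetP => i j _ _ ij.
      rewrite predeqE => -[n m] /=; split => //= -[] [_] _ [<-{n} _].
      by move=> [m' _] [] /esym/eqP; rewrite (negbTE ij).
    - exact: G_ge0.
  rewrite -(image_id [set: nat]) -fun_true esum_pred_image//; last first.
    by move=> n _; apply: esum_ge0 => x _; exact: G_ge0.
  apply: eq_eseriesr => /= j _.
  rewrite -(esum_pred_image (vol \o uncurry G) (pair j) predT)//=; last 2 first.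
    by move=> n _; exact: (box_volume_ge0 (PG j).1 n).
    by move=> ? ? _ _; exact: (@can_inj _ _ _ snd).
  by congr esum; rewrite predeqE => -[a b]; split; move=> [i _ <-]; exists i.
apply: lee_lim.
- apply: is_cvg_nneseries => n *.
  by apply: nneseries_ge0 => m *; exact: (G_ge0 (n, m)).
- by apply: is_cvg_nneseries => n *; rewrite adde_ge0// lebesgue_outer_ge0.
- by near=> n; apply: lee_sum => i _; exact: (PG i).2.
Unshelve. all: by end_near. Qed.

HB.instance Definition _ := isOuterMeasure.Build R V lebesgue_outer
  lebesgue_outer0 lebesgue_outer_ge0 lebesgue_outer_le
  lebesgue_outer_sigma_subadditive.

(* [lebesgueRn] is convertible to ['rV[R]_d.+1] but carries the sigma-algebra of
   Lebesgue measurable sets, i.e. the Caratheodory measurable sets of the outer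
   measure, whereas ['rV[R]_d.+1] carries the topology. *)
Definition lebesgueRn : measurableType _ := caratheodory_type lebesgue_outer.

Definition lebesgueRn_measure : set lebesgueRn -> \bar R := lebesgue_outer.

HB.instance Definition _ := isMeasure.Build _ _ _ lebesgueRn_measure
  (@caratheodory_measure0 R V lebesgue_outer)
  (@caratheodory_measure_ge0 R V lebesgue_outer)
  (@caratheodory_measure_sigma_additive R V lebesgue_outer).

End LebesgueMeasure.
Arguments lebesgueRn R d : clear implicits.
Arguments lebesgueRn_measure R d : clear implicits.

Section FunctionSpaces.
Context {R : realType} {d : nat}.
Local Notation V := 'rV[R]_d.+1.
Local Notation Rn := (lebesgueRn R d).
Local Notation mu := (lebesgueRn_measure R d).
Local Notation Re := (@complex.Re R).
Local Notation Im := (@complex.Im R).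

(* Elements of function spaces are represented by everywhere defined functions;
   the norms below only depend on their classes modulo almost everywhere
   equality. *)

Definition modulus (z : R[i]) : R := Re `|z|.

Definition measurable_C (f : V -> R[i]) : Prop :=
  measurable_fun [set: Rn] (Re \o f : Rn -> R) /\
  measurable_fun [set: Rn] (Im \o f : Rn -> R).

Definition variable_exponent (p : V -> \bar R) : Prop :=
  [/\ measurable_fun [set: Rn] (p : Rn -> \bar R),
      forall x, (1 <= p x)%E,
      (1 < ess_inf mu p)%E & (ess_sup mu p < +oo)%E].

(* [fine] is harmless: exponents satisfying [variable_exponent] are finite
   almost everywhere. *)
Definition modular (p : V -> \bar R) (f : V -> R[i]) : \bar R :=
  (\int[mu]_(x in [set: Rn]) (modulus (f x) `^ fine (p x))%:E)%E.

Definition var_norm (p : V -> \bar R) (f : V -> R[i]) : \bar R :=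
  ereal_inf [set l%:E | l in [set l : R | 0 < l /\
    (modular p (fun x => (f x / l%:C)%R) <= 1)%E]].

Definition var_Lebesgue (p : V -> \bar R) : set (V -> R[i]) :=
  [set f | measurable_C f /\ (var_norm p f < +oo)%E].

Definition cut (f : V -> R[i]) (A : set V) : V -> R[i] :=
  fun x => if x \in A then f x else 0.

Definition var_Lebesgue_loc (p : V -> \bar R) : set (V -> R[i]) :=
  [set f | measurable_C f /\
           forall K : set V, compact K -> var_Lebesgue p (cut f K)].

Definition cube (r : R) (k : 'rV[int]_d.+1) : set V :=
  box (\row_j (r * (k ord0 j)%:~R), \row_j (r * (k ord0 j + 1)%:~R)).

Definition lq_norm (I : choiceType) (q : \bar R) (u : I -> \bar R) : \bar R :=
  if q is r%:E then ((\esum_(k in [set: I]) (`|u k| `^ r)) `^ r^-1)%E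
  else ereal_sup [set `|u k|%E | k in [set: I]].

Definition amalgam_norm (p : V -> \bar R) (q : \bar R) (f : V -> R[i]) :
    \bar R :=
  lq_norm q (fun k => var_norm p (cut f (cube 1 k))).

Definition dilation (alpha rho : R) (f : V -> R[i]) : V -> R[i] :=
  fun x => (rho `^ (- (d.+1%:R / alpha)))%:C * f (rho^-1 *: x).

Definition fofana_norm (p : V -> \bar R) (q : \bar R) (alpha : R)
    (f : V -> R[i]) : \bar R :=
  ereal_sup [set amalgam_norm p q (dilation alpha rho f)
            | rho in [set rho : R | 0 < rho]].

Definition fofana (p : V -> \bar R) (q : \bar R) (alpha : R) :
    set (V -> R[i]) :=
  [set f | var_Lebesgue_loc p f /\ (fofana_norm p q alpha f < +oo)%E].

(* [<=] is the partial order of [R[i]], in which comparable elements have equal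
   imaginary parts; the [f_ n] are hence real-valued almost everywhere. *)
Definition fofana_abs_cont (p : V -> \bar R) (q : \bar R) (alpha : R) :
    set (V -> R[i]) :=
  [set f | fofana p q alpha f /\
    forall f_ : nat -> V -> R[i],
      (forall n, fofana p q alpha (f_ n)) ->
      (forall n, {ae mu, forall x, f_ n.+1 x <= f_ n x <= `|f x|}) ->
      {ae mu, forall x, modulus (f_ n x) @[n --> \oo] --> (0 : R)} ->
      fofana_norm p q alpha (f_ n) @[n --> \oo] --> 0%E].

Definition fofana_closure (p : V -> \bar R) (q : \bar R) (alpha : R)
    (S : set (V -> R[i])) : set (V -> R[i]) :=
  [set f | fofana p q alpha f /\
    forall e : R, 0 < e ->
      exists2 g, S g & (fofana_norm p q alpha (f \- g)%R < e%:E)%E].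

Fixpoint C_k (k : nat) (f : V -> R) : Prop :=
  continuous f /\
  if k is k'.+1 then
    forall i : 'I_d.+1,
      (forall x, derivable f x (delta_mx ord0 i)) /\
      C_k k' (fun x => 'D_(delta_mx ord0 i) f x)
  else True.

Definition smooth_compact : set (V -> R[i]) :=
  [set f : V -> R[i] |
    (forall k, C_k k (Re \o f) /\ C_k k (Im \o f)) /\
    compact (closure [set x | f x != 0])].

Definition Lebesgue_space (alpha : R) : set (V -> R[i]) :=
  [set f | measurable_C f /\
           (Lnorm mu alpha%:E (fun x : Rn => (modulus (f x))%:E) < +oo)%E].

End FunctionSpaces.

(* Main.v *)
Require Import Defs.
From mathcomp Require Import all_boot all_order all_algebra.
From mathcomp Require Import all_classical all_reals all_analysis.
From mathcomp Require Import measurable_realfun complex ring lra.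

Set Implicit Arguments.
Unset Strict Implicit.
Unset Printing Implicit Defensive.

Import Order.TTheory GRing.Theory Num.Theory.
Import numFieldNormedType.Exports HBNNSimple.

Local Open Scope classical_set_scope.
Local Open Scope ring_scope.

Local Notation cut := Defs.cut.

(** Write X for the Fofana space and |f|_X for its norm. Two estimates carry
    the proof.

    The first is a quasi-triangle inequality [fofana_norm_quasi_triangle]: if
    |h| <= |f| + |g| almost everywhere and f, g have norm at most c, then h has
    norm at most 8c. Every step of the definition (modular, Luxemburg norm,
    l^q norm, supremum over dilations) is monotone, so the pointwise inequality
    ((x + y) / 4)^s <= (x^s + y^s) / 2 gives it without Minkowski's inequality;
    a fixed constant is harmless because only smallness of norms is at stake.

    The second is the embedding [fofana_norm_le_integral]: |h|_X is at most
    twice the L^alpha norm of h. On a unit cube, p <= alpha gives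
    y^p(x) <= 1 + y^alpha, so that the L^p norm is at most twice the L^alpha
    norm there; since alpha <= q, the l^q norm of the local norms is at most
    their l^alpha norm, which is the global L^alpha norm; and the dilations
    St_rho preserve the L^alpha norm.

    Now let f have absolutely continuous norm, and let G_n be the set where
    |f| <= n inside the cube [-n, n[^d. The functions |f| 1_(~ G_n) decrease to
    0, so they tend to 0 in X; and f 1_(G_n) is in L^alpha, where smooth
    compactly supported functions are dense, hence by the embedding it is
    approximated in X by such functions. Conversely, let f be a limit in X of functions g of
    L^alpha and let |f| >= f_n decrease to 0. Then
    f_n <= min(f_n, |g|) + |f - g|, where the first term tends to 0 in L^alpha
    by dominated convergence, hence in X, and the second is small in X. As
    smooth compactly supported functions are in L^alpha, the closures of both
    classes are the space of functions of absolutely continuous norm.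

    The measure is built from coverings by boxes, so its basic theory is part
    of the proof: open sets are measurable ([open_measurableRn]), the measure
    is homogeneous under dilations ([lebesgue_dilation]), and the unit cube has
    positive measure ([lebesgue_unit_box_ge1]). The last fact is what turns the
    almost everywhere bound p <= alpha into 1 <= alpha. Density in L^alpha
    ([smooth_compact_dense]) reduces, through simple functions and outer
    regularity, to the indicator of a finite union of boxes, which is a
    pointwise limit of explicit smooth functions built from exp(-1/t). *)

(** * Lebesgue measure on Euclidean space: boxes, open sets, dilations *)

Section LebesgueRn.
Context {R : realType} {d : nat}.
Local Notation V := 'rV[R]_d.+1.
Local Notation Rn := (lebesgueRn R d).
Local Notation mu := (lebesgueRn_measure R d).
Local Notation vol ab := ((box_volume ab)%:E).

Lemma box_volume_split (a b : V) (i : 'I_d.+1) (m : R) :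
  box_volume (a, \row_j (if j == i then m else b ord0 j)) +
  box_volume (\row_j (if j == i then m else a ord0 j), b) = box_volume (a, b).
Proof.
rewrite /box_volume /= (bigD1 i)//= [X in _ + X](bigD1 i)//= [RHS](bigD1 i)//=.
rewrite !mxE eqxx.
rewrite (eq_bigr (fun j => b ord0 j - a ord0 j)); last first.
  by move=> j /negbTE ji; rewrite !mxE ji.
rewrite [X in _ + _ * X](eq_bigr (fun j => b ord0 j - a ord0 j)); last first.
  by move=> j /negbTE ji; rewrite !mxE ji.
by rewrite -mulrDl; congr (_ * _); ring.
Qed.

(** Cutting each box of a cover of X along the hyperplane x_i = c gives covers of
    both parts of X with the same total volume. *)
Lemma halfspace_caratheodory (i : 'I_d.+1) (c : R) :
  (@lebesgue_outer R d).-caratheodory [set x : V | x ord0 i < c].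
Proof.
apply: le_caratheodory_measurable => X.
apply: le_ereal_inf_tmp => _ [B [leB XB] <-].
(* c clamped to the i-th side of the box, so that both pieces are boxes *)
pose m k := Num.max ((B k).1 ord0 i) (Num.min ((B k).2 ord0 i) c).
pose B1 k := ((B k).1, \row_j (if j == i then m k else (B k).2 ord0 j)) : V * V.
pose B2 k := (\row_j (if j == i then m k else (B k).1 ord0 j), (B k).2) : V * V.
have m_itv k : (B k).1 ord0 i <= m k <= (B k).2 ord0 i.
  by rewrite /m le_max lexx ge_max leB ge_min lexx.
have cov1 : box_cover (X `&` [set x : V | x ord0 i < c]) B1.
  split=> [k j|x [/XB[k _ Bx] /= xc]]; rewrite /B1 /=.
    by rewrite mxE; case: eqP => [->|_]//; case/andP: (m_itv k).
  exists k => // j; have /andP[aj bj] := Bx j.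
  rewrite /= mxE aj /=; case: eqP => // ji.
  by rewrite /m lt_max lt_min -ji bj ji xc orbT.
have cov2 : box_cover (X `&` ~` [set x : V | x ord0 i < c]) B2.
  split=> [k j|x [/XB[k _ Bx] /= /negP]]; rewrite /B2 /=.
    by rewrite mxE; case: eqP => [->|_]//; case/andP: (m_itv k).
  rewrite -leNgt => xc; exists k => // j; have /andP[aj bj] := Bx j.
  rewrite /= mxE bj andbT; case: eqP => // ji.
  by rewrite /m ge_max ge_min -ji aj ji xc orbT.
have -> : (\sum_(k <oo) vol (B k) =
    \sum_(k <oo) vol (B1 k) + \sum_(k <oo) vol (B2 k))%E.
  rewrite -nneseriesD; last 2 first.
    by move=> k _ _; exact: (box_volume_ge0 cov1).
    by move=> k _ _; exact: (box_volume_ge0 cov2).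
  apply: eq_eseriesr => k _; rewrite -EFinD /B1 /B2 box_volume_split.
  by case: (B k).
by apply: leeD; apply: ereal_inf_lbound; [exists B1|exists B2].
Qed.

Lemma measurable_coord (i : 'I_d.+1) :
  measurable_fun [set: Rn] ((fun x : V => x ord0 i) : Rn -> R).
Proof.
move=> mT; apply: (measurability _ (RGenCInfty.measurableE R)) => //.
move=> _ [_ [c ->] <-]; rewrite setTI.
rewrite (_ : _ @^-1` _ = ~` [set x : V | x ord0 i < c]); last first.
  apply/seteqP; split=> x /=; rewrite in_itv/= andbT leNgt; [by move/negP|].
  by move/negP.
by apply: measurableC; exact: halfspace_caratheodory.
Qed.

Lemma measurable_box (ab : V * V) : measurable (box ab : set Rn).
Proof.
rewrite (_ : box ab = \bigcap_i
    ((fun x : V => x ord0 i) @^-1` `[ab.1 ord0 i, ab.2 ord0 i[)); last first.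
  apply/seteqP; split=> [x bx i _|x bx i]; first by rewrite /= in_itv/= bx.
  by have := bx i I; rewrite /= in_itv.
apply: fin_bigcap_measurable => // i _.
rewrite -[X in measurable X]setTI; exact: measurable_coord.
Qed.

(** An open set is the union of the countably many boxes with rational corners
    that it contains. *)
Lemma open_measurableRn (O : set V) : open O -> measurable (O : set Rn).
Proof.
move=> oO.
pose rbox (k : 'rV[rat]_d.+1 * 'rV[rat]_d.+1) : set V :=
  box (map_mx ratr k.1, map_mx ratr k.2).
have -> : O = \bigcup_(k in [set k | rbox k `<=` O]) rbox k.
  apply/seteqP; split=> [x Ox|x [k kO] /kO//].
  have [e /= e0 xeO] := (nbhs_ballP _ _).1 (open_nbhs_nbhs (conj oO Ox)).
  have Pa i : exists r : rat, ratr r \in `]x ord0 i - e, x ord0 i[.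
    by apply: rat_in_itvoo; rewrite gtrBl.
  have Pb i : exists r : rat, ratr r \in `]x ord0 i, x ord0 i + e[.
    by apply: rat_in_itvoo; rewrite ltrDl.
  have [a Ha] := choice Pa; have [b Hb] := choice Pb.
  exists (\row_i a i, \row_i b i) => /=; last first.
    move=> i /=; rewrite !mxE; have := Ha i; have := Hb i.
    by rewrite !in_itv /= => /andP[xb _] /andP[_ /ltW ->]; rewrite xb.
  move=> y Hy; apply: xeO; split=> // i j; rewrite ord1.
  have := Hy j; rewrite !mxE /= => /andP[ay yb]; have := Ha j; have := Hb j.
  rewrite !in_itv /= => /andP[_ be] /andP[ae _].
  rewrite /ball /= ltr_distlC; apply/andP; split.
    exact: lt_le_trans ay.
  exact: lt_trans be.
rewrite bigcup_mkcond; apply: countable_bigcupT_measurable => // k.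
by case: ifP => // _; exact: measurable_box.
Qed.

Lemma closed_measurableRn (F : set V) : closed F -> measurable (F : set Rn).
Proof.
move=> /closed_openC oF; rewrite -(setCK F); apply: measurableC.
exact: open_measurableRn.
Qed.

Lemma compact_measurableRn (K : set V) : compact K -> measurable (K : set Rn).
Proof.
by move=> cK; apply: closed_measurableRn; apply: compact_closed.
Qed.

Lemma continuous_measurableRn (f : V -> R) :
  continuous f -> measurable_fun [set: Rn] (f : Rn -> R).
Proof.
move=> /continuousP cf; move=> mT.
apply: (measurability _ (RGenOpens.measurableE R)) => //.
move=> _ [_ [a [b ->] <-]]; rewrite setTI.
by apply: open_measurableRn; apply: cf; exact: interval_open.
Qed.

Lemma lebesgue_box_le (ab : V * V) :
  (forall i, ab.1 ord0 i <= ab.2 ord0 i) -> (mu (box ab) <= vol ab)%E.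
Proof.
move=> leab; apply: ereal_inf_lbound.
exists (fun k => if k == 0%N then ab else (0, 0)).
  split; first by move=> k i; case: ifP.
  by move=> x xab; exists 0%N.
have vol0 : box_volume (0 : V, 0 : V) = 0.
  by rewrite /box_volume (bigD1 ord0)//= subrr mul0r.
rewrite nneseries_recl//.
  rewrite eseries0 ?adde0// => k k0 _ /=.
  by rewrite eqn0Ngt k0 vol0.
move=> k _; case: ifP => _; rewrite ?vol0// lee_fin.
by apply: prodr_ge0 => i _; rewrite subr_ge0.
Qed.

Lemma lebesgue_box_lty (ab : V * V) : (mu (box ab) < +oo)%E.
Proof.
have [leab|/forallP leab] := boolP [forall i, ab.1 ord0 i <= ab.2 ord0 i].
  by apply: le_lt_trans (lebesgue_box_le _) _; [exact/forallP|rewrite ltry].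
rewrite (_ : box ab = set0) ?measure0 ?ltry//.
apply/seteqP; split=> // x xab; apply: leab => i.
by have /andP[? /ltW] := xab i; exact: le_trans.
Qed.

Lemma compact_box (K : set V) : compact K ->
  exists M : R, K `<=` box (const_mx (- M), const_mx M).
Proof.
move=> /compact_bounded [M [_ KM]].
exists (Num.max M 0 + 2) => x Kx i; rewrite !mxE.
have /= xM := KM (Num.max M 0 + 1) _ x Kx.
have {}xM : `|x| <= Num.max M 0 + 1.
  by apply: xM; rewrite ltr_pwDr// le_max lexx.
have : `|x ord0 i| <= Num.max M 0 + 1.
  by apply: le_trans xM; rewrite /Num.Def.normr/= mx_normrE; exact: (le_bigmax _ _ (ord0, i)).
rewrite ler_norml => /andP[h1 h2]; apply/andP; split.
  apply: le_trans h1; rewrite lerN2; lra.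
apply: le_lt_trans h2 _; lra.
Qed.

Lemma lebesgue_compact_lty (K : set V) : compact K -> (mu K < +oo)%E.
Proof.
move=> /compact_box[M KM].
by apply: le_lt_trans (lebesgue_box_lty _); exact: lebesgue_outer_le KM.
Qed.

End LebesgueRn.

Section BoxVolumeCover.
Context {R : realType}.

(** Covers of the unit cube have volume at least 1, by integrating one coordinate
    at a time against the one-dimensional Lebesgue measure. The weights [c k]
    make the induction work: once the last coordinate t is fixed, the factor
    1_[a k n, b k n[(t) is absorbed in the weight. *)
Lemma cover_volume_ge1 (n : nat) (a b : nat -> nat -> R) (c : nat -> R) :
  (forall k, 0 <= c k) -> (forall k i, a k i <= b k i) ->
  (forall x : nat -> R, (forall i, 0 <= x i < 1) ->
    (1 <= \sum_(k <oo)
       (c k * \prod_(i < n) (a k i <= x i < b k i)%R%:R)%:E)%E) ->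
  (1 <= \sum_(k <oo) (c k * \prod_(i < n) (b k i - a k i))%:E)%E.
Proof.
elim: n c => [|n IHn] c c0 ab H.
  apply: (le_trans (H (fun=> 0) _)) => [i|]; first by rewrite lexx ltr01.
  by apply: lee_nneseries => k; rewrite !big_ord0 ?mulr1 ?lee_fin.
pose F k (t : R) : \bar R := (c k * (a k n <= t < b k n)%R%:R *
  \prod_(i < n) (b k i - a k i))%:E.
have prod0 k : 0 <= \prod_(i < n) (b k i - a k i).
  by apply: prodr_ge0 => i _; rewrite subr_ge0.
have F0 k t : (0 <= F k t)%E by rewrite lee_fin !mulr_ge0.
have FE k : F k = fun t => (((c k * \prod_(i < n) (b k i - a k i))%:E) *
    (\1_`[a k n, b k n[ t)%:E)%E.
  apply/funext => t; rewrite /F -EFinM indicE mem_setE in_itv/=; congr EFin; ring.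
have mF (k : nat) (D : set R) : measurable_fun D (F k).
  rewrite FE; apply: measurable_funeM.
  exact/measurable_EFinP/measurable_indic.
have F1 t : 0 <= t < 1 -> (1 <= \sum_(k <oo) F k t)%E.
  move=> t01; apply: (IHn (fun k => c k * (a k n <= t < b k n)%R%:R)) => //.
    by move=> k; rewrite mulr_ge0.
  move=> x x01; have := H (fun i => if (i < n)%N then x i else t).
  have y01 i : 0 <= (if (i < n)%N then x i else t) < 1 by case: ifP.
  move=> /(_ y01) /le_trans; apply; apply: lee_nneseries.
    by move=> k _; rewrite lee_fin mulr_ge0// prodr_ge0.
  move=> k _; rewrite big_ord_recr/= ltnn lee_fin.
  rewrite (eq_bigr (fun i : 'I_n => (a k i <= x i < b k i)%R%:R)) => [|i _].
    by rewrite -mulrA [X in _ * X]mulrC.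
  by rewrite ltn_ord.
pose I : set R := `[0, 1[%classic.
have mI : measurable I by exact: measurable_itv.
have -> : 1%E = (\int[@lebesgue_measure R]_(t in I) (cst 1 t))%E.
  rewrite integral_cst//= mul1e /I.
  have := @lebesgue_measure_itv R `[0, 1[.
  by rewrite /= lte_fin ltr01 oppr0 adde0.
apply: (@le_trans _ _ (\int[@lebesgue_measure R]_(t in I)
    \sum_(k <oo) F k t)%E).
  apply: ge0_le_integral => //.
    by apply: ge0_emeasurable_sum => k *; [exact: F0|exact: mF].
rewrite integral_nneseries//; last by move=> k; exact: mF.
apply: lee_nneseries => k; first by move=> *; apply: integral_ge0 => *; exact: F0.
move=> _.
rewrite FE ge0_integralZl//; last 2 first.
- exact/measurable_EFinP/measurable_indic.
- by rewrite lee_fin mulr_ge0.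
rewrite integral_indic//= big_ord_recr/= mulrA [leRHS]EFinM.
apply: lee_wpmul2l; first by rewrite lee_fin mulr_ge0.
apply: (@le_trans _ _ (@lebesgue_measure R `[a k n, b k n[%classic)).
  exact: measureIl.
rewrite lebesgue_measure_itv/= lte_fin; case: ifP => // _.
by rewrite lee_fin subr_ge0.
Qed.

End BoxVolumeCover.

Lemma integral_scaling_map d (T : measurableType d) (R : realType)
    (mu : {measure set T -> \bar R}) (phi : T -> T) (c : {nonneg R})
    (F : T -> \bar R) :
  measurable_fun [set: T] phi ->
  (forall A, measurable A -> mu (phi @^-1` A) = (c%:num%:E * mu A)%E) ->
  measurable_fun [set: T] F -> (forall x, 0 <= F x)%E ->
  (\int[mu]_(x in [set: T]) F (phi x) =
   c%:num%:E * \int[mu]_(x in [set: T]) F x)%E.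
Proof.
move=> mphi mu_phi mF F0.
rewrite -ge0_integral_mscale// -[LHS](ge0_integral_pushforward mphi mu _ mF)//.
by apply: eq_measure_integral => A mA _; exact: mu_phi.
Qed.

Section LebesgueDilation.
Context {R : realType} {d : nat}.
Local Notation V := 'rV[R]_d.+1.
Local Notation Rn := (lebesgueRn R d).
Local Notation mu := (lebesgueRn_measure R d).

Lemma lebesgue_unit_box_ge1 : (1 <= mu (box ((0 : V)%R, const_mx 1%R)))%E.
Proof.
apply: le_ereal_inf_tmp => _ [B [leB cov] <-].
pose a k i := (B k).1 ord0 (inord i : 'I_d.+1).
pose b k i := (B k).2 ord0 (inord i : 'I_d.+1).
have := @cover_volume_ge1 R d.+1 a b (fun=> 1) (fun=> ler01).
have ab k i : a k i <= b k i by exact: leB.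
move=> /(_ ab) H.
have {}H : (1 <= \sum_(k <oo) (1 * \prod_(i < d.+1) (b k i - a k i))%:E)%E.
  apply: H => x x01.
  have [k _ Bk] : (\bigcup_k box (B k)) (\row_i x i : V).
    by apply: cov => i; rewrite !mxE; exact: x01.
  apply: (@le_trans _ _ (\sum_(i < k.+1)
     (1 * \prod_(j < d.+1) (a i j <= x j < b i j)%R%:R)%:E)%E).
    rewrite big_ord_recr/= -[leLHS]add0e leeD//.
      by apply: sume_ge0 => i _; rewrite lee_fin mul1r prodr_ge0.
    rewrite lee_fin mul1r big1// => i _.
    by have := Bk i; rewrite mxE /a /b inord_val => ->.
  rewrite -(big_mkord xpredT (fun i =>
    (1 * \prod_(j < d.+1) (a i j <= x j < b i j)%R%:R)%:E)%E).
  apply: nneseries_lim_ge => i _ _.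
  by rewrite lee_fin mul1r prodr_ge0.
apply: le_trans H _; apply: lee_nneseries => k _.
  by rewrite lee_fin mul1r prodr_ge0// => i _; rewrite subr_ge0.
rewrite lee_fin mul1r /box_volume le_eqVlt; apply/orP; left; apply/eqP.
by apply: eq_bigr => i _; rewrite /a /b inord_val.
Qed.

(** Dilating the boxes of a cover of X gives a cover of the preimage. *)
Lemma lebesgue_dilation_le (r : R) (X : set V) : 0 < r ->
  ((r ^+ d.+1)%:E * mu ((fun x : V => r *: x) @^-1` X) <= mu X)%E.
Proof.
move=> r0; apply: le_ereal_inf_tmp => _ [B [leB cov] <-].
pose B' k := (r^-1 *: (B k).1, r^-1 *: (B k).2) : V * V.
have cov' : box_cover ((fun x : V => r *: x) @^-1` X) B'.
  split=> [k i|x /= /cov[k _ Bk]].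
    by rewrite !mxE ler_wpM2l// invr_ge0 ltW.
  exists k => // i; have := Bk i; rewrite !mxE => /andP[h1 h2].
  by rewrite ler_pdivrMl// h1 ltr_pdivlMl.
apply: (@le_trans _ _ ((r ^+ d.+1)%:E * \sum_(k <oo) (box_volume (B' k))%:E)%E).
  apply: lee_wpmul2l; first by rewrite lee_fin exprn_ge0// ltW.
  by apply: ereal_inf_lbound; exists B'.
rewrite -nneseriesZl; last by move=> k _; exact: (box_volume_ge0 cov').
apply: lee_nneseries => k _.
  by rewrite mule_ge0 ?lee_fin ?exprn_ge0 ?(ltW r0)//; exact: (box_volume_ge0 cov').
rewrite -EFinM lee_fin /box_volume -{1}(card_ord d.+1) -prodr_const -big_split/=.
rewrite le_eqVlt; apply/orP; left; apply/eqP; apply: eq_bigr => i _.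
by rewrite !mxE -mulrBr mulrA divff ?gt_eqF// mul1r.
Qed.

(** The converse inequality is [lebesgue_dilation_le] for the inverse
    dilation. *)
Lemma lebesgue_dilation (r : R) (X : set V) : 0 < r ->
  mu ((fun x : V => r *: x) @^-1` X) = ((r ^- d.+1)%:E * mu X)%E.
Proof.
move=> r0; have rn0 : 0 < r ^+ d.+1 by rewrite exprn_gt0.
apply/eqP; rewrite eq_le; apply/andP; split.
  have := lebesgue_dilation_le X r0.
  move=> /(lee_wpmul2l (x := (r ^- d.+1)%:E)); rewrite lee_fin invr_ge0.
  by rewrite (ltW rn0) muleA -EFinM mulVf ?gt_eqF// mul1e; apply.
have := @lebesgue_dilation_le r^-1 ((fun x : V => r *: x) @^-1` X).
rewrite invr_gt0 exprVn => /(_ r0); rewrite -comp_preimage.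
rewrite (_ : _ \o _ = id) ?preimage_id//.
by apply/funext => x /=; rewrite scalerA divff ?gt_eqF// scale1r.
Qed.

(** Lebesgue measurability is not a topological property, so continuity of the
    dilation is not enough: the splitting identity for a test set Y follows from
    the one for its image under the dilation, as the outer measure is
    homogeneous. *)
Lemma measurable_dilation (r : R) : 0 < r ->
  measurable_fun [set: Rn] ((fun x : V => r *: x) : Rn -> Rn).
Proof.
move=> r0 _ A mA; rewrite setTI.
apply: le_caratheodory_measurable => Y.
pose X := (fun x : V => r^-1 *: x) @^-1` Y.
have YX : Y = (fun x : V => r *: x) @^-1` X.
  rewrite /X -comp_preimage (_ : _ \o _ = id) ?preimage_id//.
  by apply/funext => x /=; rewrite scalerA mulVf ?gt_eqF// scale1r.
have := mA X; rewrite /= => XA.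
have E Z := lebesgue_dilation Z r0.
rewrite YX preimage_setC -!preimage_setI.
move: E; rewrite /lebesgueRn_measure => E; rewrite !E -ge0_muleDr.
- by rewrite -XA.
- exact: lebesgue_outer_ge0.
- exact: lebesgue_outer_ge0.
Qed.

Lemma integral_dilation (r : R) (F : V -> \bar R) : 0 < r ->
  measurable_fun [set: Rn] (F : Rn -> \bar R) -> (forall x, 0 <= F x)%E ->
  (\int[mu]_(x in [set: Rn]) F (r *: x) =
   (r ^- d.+1)%:E * \int[mu]_(x in [set: Rn]) F x)%E.
Proof.
move=> r0 mF F0.
have rn0 : 0 <= r ^- d.+1 by rewrite invr_ge0 exprn_ge0// ltW.
apply: (integral_scaling_map (c := NngNum rn0) (measurable_dilation r0)) => // A _.
exact: lebesgue_dilation.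
Qed.

#[global] Instance ae_lebesgueRn_filter :
  Filter (nbhs (almost_everywhere mu)).
Proof. exact: (ae_filter_ringOfSetsType mu). Qed.

Lemma ae_dilation (r : R) (P : V -> Prop) : 0 < r ->
  {ae mu, forall x, P x} -> {ae mu, forall x, P (r *: x)}.
Proof.
move=> r0 [N [mN N0 PN]].
exists ((fun x : V => r *: x) @^-1` N); split.
- by rewrite -[X in measurable X]setTI; exact: measurable_dilation.
- by have := lebesgue_dilation N r0; rewrite [X in (_ * X)%E]N0 mule0.
- by move=> x /PN.
Qed.

End LebesgueDilation.

(** * Complex moduli and measurable complex functions *)

Section Modulus.
Context {R : realType}.
Implicit Types z w : R[i].
Local Notation Re := (@complex.Re R).
Local Notation Im := (@complex.Im R).

Lemma modulusE z : modulus z = Num.sqrt (Re z ^+ 2 + Im z ^+ 2).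
Proof. by case: z. Qed.

Lemma modulusC z : (modulus z)%:C%C = `|z|.
Proof. by case: z. Qed.

Lemma modulus_ge0 z : 0 <= modulus z.
Proof. by rewrite modulusE sqrtr_ge0. Qed.

Lemma modulus0 : modulus (0 : R[i]) = 0.
Proof. by rewrite modulusE /= expr0n/= addr0 sqrtr0. Qed.

Lemma modulusM z w : modulus (z * w) = modulus z * modulus w.
Proof. by apply: (@complexI R); rewrite rmorphM/= !modulusC normrM. Qed.

Lemma modulus_real (x : R) : modulus x%:C%C = `|x|.
Proof. by rewrite modulusE /= expr0n/= addr0 sqrtr_sqr. Qed.

Lemma modulusD z w : modulus (z + w) <= modulus z + modulus w.
Proof.
have := ler_normD z w; rewrite -!modulusC -rmorphD/=.
by rewrite lecR.
Qed.

Lemma modulus_id z : modulus `|z| = modulus z.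
Proof. by rewrite -modulusC modulus_real ger0_norm// modulus_ge0. Qed.

Lemma modulus_div (z : R[i]) (l : R) : 0 < l ->
  modulus (z / l%:C%C) = modulus z / l.
Proof.
move=> l0; rewrite modulusM -fmorphV modulus_real ger0_norm// invr_ge0.
exact: ltW.
Qed.

Lemma modulus_le z : modulus z <= `|Re z| + `|Im z|.
Proof.
rewrite modulusE -[leRHS]ger0_norm ?addr_ge0// -sqrtr_sqr ler_wsqrtr// sqrrD.
by rewrite !real_normK ?num_real// lerD2r lerDl mulrn_wge0// mulr_ge0.
Qed.

End Modulus.

Section Measurability.
Context {R : realType} {d : nat}.
Local Notation V := 'rV[R]_d.+1.
Local Notation Rn := (lebesgueRn R d).
Local Notation mu := (lebesgueRn_measure R d).
Local Notation Re := (@complex.Re R).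
Local Notation Im := (@complex.Im R).
Implicit Types f g h : V -> R[i].

Lemma measurable_modulus f : measurable_C f ->
  measurable_fun [set: Rn] ((fun x => modulus (f x)) : Rn -> R).
Proof.
move=> [mRe mIm].
rewrite (_ : (fun x => _) =
    fun x : Rn => Num.sqrt (Re (f x) ^+ 2 + Im (f x) ^+ 2)); last first.
  by apply/funext => x; rewrite modulusE.
apply: (measurableT_comp (continuous_measurable_fun (@sqrt_continuous R))).
by apply: measurable_funD; apply: measurable_funX.
Qed.

Lemma measurable_C_real (f : V -> R) : measurable_fun [set: Rn] (f : Rn -> R) ->
  measurable_C (fun x => (f x)%:C%C).
Proof. by move=> mf; split; [exact: mf|exact: measurable_cst]. Qed.

Lemma measurable_CB f g : measurable_C f -> measurable_C g ->
  measurable_C (f \- g)%R.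
Proof.
move=> [mf1 mf2] [mg1 mg2]; split.
  rewrite (_ : _ \o _ = (Re \o f) \- (Re \o g)); first exact: measurable_funB.
  by apply/funext => x /=; case: (f x); case: (g x).
rewrite (_ : _ \o _ = (Im \o f) \- (Im \o g)); first exact: measurable_funB.
by apply/funext => x /=; case: (f x); case: (g x).
Qed.

Lemma measurable_C_scale (c : R) f : measurable_C f ->
  measurable_C (fun x => c%:C%C * f x).
Proof.
move=> [mf1 mf2]; split.
  rewrite (_ : _ \o _ = (fun x => c * (Re \o f) x)); first exact: measurable_funM.
  by apply/funext => x /=; case: (f x) => a b /=; rewrite mul0r subr0.
rewrite (_ : _ \o _ = (fun x => c * (Im \o f) x)); first exact: measurable_funM.
by apply/funext => x /=; case: (f x) => a b /=; rewrite mul0r addr0.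
Qed.

Lemma measurable_C_div (l : R) f : measurable_C f ->
  measurable_C (fun x => f x / l%:C%C).
Proof.
move=> /(@measurable_C_scale l^-1); congr measurable_C.
by apply/funext => x; rewrite mulrC fmorphV.
Qed.

Lemma measurable_C_cut (A : set V) f : measurable (A : set Rn) ->
  measurable_C f -> measurable_C (cut f A).
Proof.
move=> mA [mf1 mf2].
have mI : measurable_fun [set: Rn] (\1_A : Rn -> R) by exact: measurable_indic.
split.
  rewrite (_ : _ \o _ = (fun x => (Re \o f) x * \1_A x)).
    exact: measurable_funM.
  by apply/funext => x /=; rewrite /cut indicE; case: (x \in A); rewrite ?mulr1 ?mulr0.
rewrite (_ : _ \o _ = (fun x => (Im \o f) x * \1_A x)).
  exact: measurable_funM.
by apply/funext => x /=; rewrite /cut indicE; case: (x \in A); rewrite ?mulr1 ?mulr0.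
Qed.

Lemma measurable_C_dilation (a rho : R) f : 0 < rho ->
  measurable_C f -> measurable_C (dilation a rho f).
Proof.
move=> rho0 [mf1 mf2]; apply: measurable_C_scale.
have r0 : 0 < rho^-1 by rewrite invr_gt0.
have md := @measurable_dilation R d _ r0.
by split; [exact: (measurableT_comp mf1 md)|exact: (measurableT_comp mf2 md)].
Qed.

Lemma measurable_powR_fun d' (T : measurableType d') (f s : T -> R) :
  measurable_fun [set: T] f -> measurable_fun [set: T] s ->
  measurable_fun [set: T] (fun x => f x `^ s x).
Proof.
move=> mf ms; rewrite /powR; apply: measurable_fun_ifT.
- exact: measurable_fun_eqr.
- rewrite (_ : (fun x => _) = (fun x => if s x == 0 then 1 else 0)); last first.
    by apply/funext => x; case: eqP.
  by apply: measurable_fun_ifT => //; exact: measurable_fun_eqr.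
- apply: measurableT_comp => //; apply: measurable_funM => //.
  exact: measurableT_comp.
Qed.

Lemma measurable_modulus_powR (a : R) f : measurable_C f ->
  measurable_fun [set: Rn] ((fun x => (modulus (f x) `^ a)%:E) : Rn -> \bar R).
Proof.
move=> mf; apply/measurable_EFinP; apply: measurable_powR_fun.
  exact: measurable_modulus.
exact: measurable_cst.
Qed.

End Measurability.

(** * Quasi-triangle inequalities *)

Section PowerInequalities.
Context {R : realType}.
Implicit Types s x y z L a : R.

(** Since z / 4 <= max(x, y) / 2 and 2^-s <= 1/2; this replaces convexity of the
    power in all triangle inequalities below. *)
Lemma powR_convex_le s x y z : 1 <= s -> 0 <= x -> 0 <= y -> 0 <= z ->
  z <= x + y -> (z / 4) `^ s <= 2^-1 * (x `^ s + y `^ s).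
Proof.
move=> s1 x0 y0 z0 zxy.
have s0 : 0 <= s by exact: le_trans s1.
pose m := Num.max x y.
have m0 : 0 <= m by rewrite le_max x0.
have zm : z / 4 <= 2^-1 * m.
  have : x <= m by rewrite le_max lexx.
  have : y <= m by rewrite le_max lexx orbT.
  lra.
apply: (@le_trans _ _ ((2^-1 * m) `^ s)).
  by apply: ge0_ler_powR => //; rewrite nnegrE ?divr_ge0 ?mulr_ge0.
rewrite powRM//; apply: ler_pM; rewrite ?powR_ge0//.
  have := @ger_powR _ (2^-1 : R) _ 1 s s1.
  by rewrite powRr1//; apply; lra.
rewrite /m; case: (leP x y) => _; [rewrite lerDr|rewrite lerDl]; exact: powR_ge0.
Qed.

Lemma powR_le_1D s a y : 1 <= s -> s <= a -> 0 <= y -> y `^ s <= 1 + y `^ a.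
Proof.
move=> s1 sa y0; have s0 : 0 <= s by exact: le_trans s1.
have [y1|/ltW y1] := leP y 1.
  apply: (@le_trans _ _ 1); last by rewrite lerDl powR_ge0.
  have e1 : (1 : R) `^ s = 1 by rewrite powR1.
  rewrite -[leRHS]e1; apply: ge0_ler_powR; rewrite ?nnegrE//.
by apply: (@le_trans _ _ (y `^ a)); [exact: ler_powR|rewrite lerDr].
Qed.

(** Dividing by L >= 1 gains a factor 1 / L whatever the exponent s >= 1 is. *)
Lemma powR_div_le s a y L : 1 <= s -> s <= a -> 0 <= y -> 1 <= L ->
  (y / L) `^ s <= L^-1 * (1 + y `^ a).
Proof.
move=> s1 sa y0 L1; have L0 : 0 < L by exact: lt_le_trans L1.
rewrite mulrC powRM ?invr_ge0 ?(ltW L0)//; apply: ler_pM; rewrite ?powR_ge0//.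
  have := @ger_powR _ L^-1 _ 1 s s1.
  by rewrite powRr1 ?invr_ge0 ?(ltW L0)//; apply; rewrite invr_gt0 L0 invf_le1.
exact: powR_le_1D.
Qed.

End PowerInequalities.

Lemma esumZl_le (R : realType) (I : choiceType) (D : set I) (f : I -> \bar R)
    (c : R) : 0 <= c -> (forall k, 0 <= f k)%E ->
  (\esum_(k in D) (c%:E * f k) <= c%:E * \esum_(k in D) f k)%E.
Proof.
move=> c0 f0; apply: ge_ereal_sup => _ [F [finF FD] <-].
rewrite -ge0_mule_fsumr//; apply: lee_wpmul2l; first by rewrite lee_fin.
by apply: ereal_sup_ubound; exists F.
Qed.

Section LqNorm.
Context {R : realType} {I : choiceType}.
Implicit Types (u v w : I -> \bar R) (q : \bar R) (c : R).

(** Norm bounds are moved inside the power, where they can be added, uniformly in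
    the finite and infinite cases. *)
Lemma lq_norm_le_powP q u c : (1 <= q)%E -> 0 <= c -> (forall k, 0 <= u k)%E ->
  ((lq_norm q u <= c%:E)%E <->
  if q is r%:E then (\esum_(k in [set: I]) u k `^ r <= (c `^ r)%:E)%E
  else forall k, (u k <= c%:E)%E).
Proof.
case: q => [r||]// r1 c0 u0; last first.
  split=> [H k|H].
    apply: le_trans H; apply: ereal_sup_ubound; exists k => //.
    by rewrite gee0_abs.
  by apply: ge_ereal_sup => _ [k _ <-]; rewrite gee0_abs.
rewrite lee_fin in r1; have r0 : 0 < r by exact: lt_le_trans r1.
have E : (\esum_(k in [set: I]) `|u k| `^ r = \esum_(k in [set: I]) u k `^ r)%E.
  by apply: eq_esum => k _; rewrite gee0_abs.
have S0 : (0 <= \esum_(k in [set: I]) u k `^ r)%E.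
  by apply: esum_ge0 => k _; exact: poweR_ge0.
rewrite /lq_norm E; split=> H.
  have := gt0_ler_poweR (ltW r0) _ _ H.
  rewrite !in_itv/= !leey !andbT poweR_ge0 lee_fin c0 => /(_ isT isT).
  by rewrite -poweRrM mulVf ?gt_eqF// poweRe1.
have rV0 : 0 <= r^-1 by rewrite invr_ge0 ltW.
have := gt0_ler_poweR rV0 _ _ H.
rewrite !in_itv/= !leey !andbT S0 lee_fin powR_ge0 => /(_ isT isT).
by rewrite -powRrM mulfV ?gt_eqF// powRr1.
Qed.

Lemma lq_norm_quasi_triangle q u v w c : (1 <= q)%E -> 0 <= c ->
  (forall k, 0 <= u k)%E -> (forall k, 0 <= v k)%E -> (forall k, 0 <= w k)%E ->
  (forall k, u k <= 4%:E * maxe (v k) (w k))%E ->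
  (lq_norm q v <= c%:E)%E -> (lq_norm q w <= c%:E)%E ->
  (lq_norm q u <= (8 * c)%:E)%E.
Proof.
move=> q1 c0 u0 v0 w0 uvw.
move=> /(lq_norm_le_powP q1 c0 v0) Hv /(lq_norm_le_powP q1 c0 w0) Hw.
apply/(lq_norm_le_powP q1 _ u0); first by rewrite mulr_ge0.
case: q q1 Hv Hw => [r||]// r1 Hv Hw; last first.
  move=> k; apply: le_trans (uvw k) _.
  apply: (@le_trans _ _ (4%:E * c%:E)%E).
    by apply: lee_wpmul2l; rewrite ?lee_fin// ge_max Hv Hw.
  rewrite -EFinM lee_fin; lra.
rewrite lee_fin in r1; have r0 : 0 <= r by exact: le_trans r1.
apply: (@le_trans _ _
    (\esum_(k in [set: I]) ((4 `^ r)%:E * (v k `^ r + w k `^ r)))%E).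
  apply: le_esum => k _.
  have := gt0_ler_poweR r0 _ _ (uvw k).
  have m0 : (0 <= maxe (v k) (w k))%E by rewrite le_max v0.
  rewrite !in_itv/= !leey !andbT u0 mule_ge0 ?lee_fin// => /(_ isT isT).
  move=> /le_trans; apply; rewrite poweRM ?lee_fin// poweR_EFin.
  apply: lee_wpmul2l; first by rewrite lee_fin powR_ge0.
  by case: (leP (v k) (w k)) => _; [rewrite leeDr|rewrite leeDl]; rewrite ?poweR_ge0.
apply: le_trans (esumZl_le _ _ _) _; first exact: powR_ge0.
  by move=> k; rewrite adde_ge0// poweR_ge0.
rewrite esumD; [|by move=> k _; exact: poweR_ge0..].
apply: (@le_trans _ _ ((4 `^ r)%:E * ((c `^ r)%:E + (c `^ r)%:E))%E).
  by apply: lee_wpmul2l; [rewrite lee_fin powR_ge0|exact: leeD].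
rewrite -EFinD -EFinM lee_fin (_ : 8 = 4 * 2); last by ring.
rewrite -mulrA powRM ?mulr_ge0// ler_wpM2l ?powR_ge0//.
have h2 : 2 <= (2 : R) `^ r by apply: le1r_powR => //; rewrite ler1n.
rewrite powRM//; have := powR_ge0 c r; nra.
Qed.

End LqNorm.

Lemma ae_le_integralT d (T : measurableType d) (R : realType)
    (mu : {measure set T -> \bar R}) (F G : T -> \bar R) :
  (forall x, 0 <= F x)%E -> (forall x, 0 <= G x)%E ->
  measurable_fun [set: T] F -> measurable_fun [set: T] G ->
  {ae mu, forall x, (F x <= G x)%E} ->
  (\int[mu]_(x in [set: T]) F x <= \int[mu]_(x in [set: T]) G x)%E.
Proof.
move=> F0 G0 mF mG FG; apply: ae_ge0_le_integral => //.
by apply: filterS FG => x Fx _.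
Qed.

Lemma le_integralT d (T : measurableType d) (R : realType)
    (mu : {measure set T -> \bar R}) (F G : T -> \bar R) :
  (forall x, 0 <= F x)%E -> measurable_fun [set: T] F ->
  measurable_fun [set: T] G -> (forall x, (F x <= G x)%E) ->
  (\int[mu]_(x in [set: T]) F x <= \int[mu]_(x in [set: T]) G x)%E.
Proof. by move=> F0 mF mG FG; apply: ge0_le_integral. Qed.

Section VarNorm.
Context {R : realType} {d : nat}.
Local Notation V := 'rV[R]_d.+1.
Local Notation Rn := (lebesgueRn R d).
Local Notation mu := (lebesgueRn_measure R d).
Variables (p : V -> \bar R) (alpha : R).
Hypothesis mp : measurable_fun [set: Rn] (p : Rn -> \bar R).
Hypothesis p1 : forall x, (1 <= p x)%E.
Hypothesis palpha : {ae mu, forall x, (p x <= alpha%:E)%E}.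
Implicit Types f g h : V -> R[i].

Lemma ae_exponent : {ae mu, forall x, 1 <= fine (p x) <= alpha}.
Proof.
apply: filterS palpha => x; have := p1 x.
by case: (p x) => [r||]//=; rewrite !lee_fin => -> ->.
Qed.

(** As p >= 1 everywhere and p <= alpha almost everywhere, alpha < 1 would make
    the whole space negligible, against [lebesgue_unit_box_ge1]. *)
Lemma alpha_ge1 : 1 <= alpha.
Proof.
apply: contrapT => /negP; rewrite -ltNge => a1.
have /negligibleP : mu.-negligible [set: Rn].
  apply: negligibleS palpha => x _ /=; apply/negP; rewrite -ltNge.
  by apply: lt_le_trans (p1 x); rewrite lte_fin.
move=> /(_ measurableT) mu0.
have := @lebesgue_unit_box_ge1 R d.
apply/negP; rewrite -ltNge.
have : (mu (box ((0 : V)%R, const_mx 1%R)) <= mu [set: Rn])%E.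
  exact: lebesgue_outer_le.
by rewrite mu0 => /le_lt_trans; apply; rewrite lte_fin.
Qed.

Lemma exponent_ge0 x : 0 <= fine (p x).
Proof.
by have := p1 x; case: (p x) => [r||]//=; rewrite !lee_fin => /(le_trans _); apply.
Qed.

Lemma measurable_modular_integrand f : measurable_C f ->
  measurable_fun [set: Rn]
    ((fun x => (modulus (f x) `^ fine (p x))%:E) : Rn -> \bar R).
Proof.
move=> mf; apply/measurable_EFinP; apply: measurable_powR_fun.
  exact: measurable_modulus.
exact: (measurableT_comp (fine_measurable measurableT)).
Qed.

Lemma var_norm_ge0 f : (0 <= var_norm p f)%E.
Proof.
by apply: le_ereal_inf_tmp => _ [l [l0 _] <-]; rewrite lee_fin ltW.
Qed.

(** The Luxemburg infimum need not be attained, but every larger number is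
    admissible. *)
Lemma var_norm_lt_modular_le1 f (l : R) : measurable_C f -> (var_norm p f < l%:E)%E ->
  (modular p (fun x => (f x / l%:C%C)%R) <= 1)%E.
Proof.
move=> mf /ereal_inf_lt[_ [l' [l'0 ml'] <-]]; rewrite lte_fin => l'l.
apply: le_trans ml'; apply: le_integralT.
- by move=> x; rewrite lee_fin powR_ge0.
- exact: measurable_modular_integrand (measurable_C_div l mf).
- exact: measurable_modular_integrand (measurable_C_div l' mf).
- have l0 : 0 < l by exact: lt_trans l'l.
  move=> x; rewrite lee_fin !modulus_div//.
  apply: ge0_ler_powR; [exact: exponent_ge0|..].
  + by rewrite nnegrE divr_ge0 ?modulus_ge0// ltW.
  + by rewrite nnegrE divr_ge0 ?modulus_ge0// ltW.
  + by rewrite ler_wpM2l ?modulus_ge0// lef_pV2 ?posrE// ltW.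
Qed.

(** If l exceeds both norms on the right, the modulars of f / l and g / l are at
    most 1, hence that of h / (4 l) is at most 1 by [powR_convex_le]. *)
Lemma var_norm_quasi_triangle f g h :
  measurable_C f -> measurable_C g -> measurable_C h ->
  {ae mu, forall x, modulus (h x) <= modulus (f x) + modulus (g x)} ->
  (var_norm p h <= 4%:E * maxe (var_norm p f) (var_norm p g))%E.
Proof.
move=> mf mg mh hfg.
have H (l : R) : (maxe (var_norm p f) (var_norm p g) < l%:E)%E ->
    (var_norm p h <= 4%:E * l%:E)%E.
  rewrite gt_max => /andP[fl gl].
  have l0 : 0 < l by rewrite -lte_fin; exact: le_lt_trans (var_norm_ge0 f) fl.
  apply: ereal_inf_lbound; exists (4 * l) => //=; split; first by rewrite mulr_gt0.
  have Hf := var_norm_lt_modular_le1 mf fl; have Hg := var_norm_lt_modular_le1 mg gl.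
  have mF f' (l' : R) (mf' : measurable_C f') :=
    measurable_modular_integrand (measurable_C_div l' mf').
  apply: (@le_trans _ _ (\int[mu]_(x in [set: Rn]) (2^-1%:E *
     ((modulus (f x / l%:C%C)%R `^ fine (p x))%:E +
      (modulus (g x / l%:C%C)%R `^ fine (p x))%:E)))%E).
    apply: ae_le_integralT.
    - by move=> x; rewrite lee_fin powR_ge0.
    - by move=> x; rewrite -EFinD -EFinM lee_fin mulr_ge0// addr_ge0 ?powR_ge0.
    - exact: mF.
    - by apply: measurable_funeM; apply: emeasurable_funD; exact: mF.
    - apply: filterS2 hfg ae_exponent => x hx /andP[p1x _].
      rewrite -EFinD -EFinM lee_fin !modulus_div// ?mulr_gt0//.
      rewrite (_ : modulus (h x) / _ = modulus (h x) / l / 4); last first.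
        by rewrite invfM; ring.
      apply: powR_convex_le; rewrite ?divr_ge0 ?modulus_ge0 ?(ltW l0)//.
      by rewrite -mulrDl ler_wpM2r// invr_ge0 ltW.
  rewrite ge0_integralZl_EFin;
    [|exact: measurableT|..|by rewrite invr_ge0]; last 2 first.
  - by move=> x _; rewrite -EFinD lee_fin addr_ge0 ?powR_ge0.
  - by apply: emeasurable_funD; exact: mF.
  rewrite ge0_integralD; [|exact: measurableT|..]; last 4 first.
  - by move=> x _; rewrite lee_fin powR_ge0.
  - exact: mF.
  - by move=> x _; rewrite lee_fin powR_ge0.
  - exact: mF.
  apply: (@le_trans _ _ (2^-1%:E * (1 + 1))%E).
    by apply: lee_wpmul2l; [rewrite lee_fin invr_ge0|exact: leeD Hf Hg].
  by rewrite -EFinD -EFinM lee_fin; lra.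
have : (0 <= maxe (var_norm p f) (var_norm p g))%E.
  by rewrite le_max; apply/orP; left; exact: var_norm_ge0.
move: H; case: (maxe _ _) => [M||] H M0.
- apply/lee_addgt0Pr => e e0.
  apply: le_trans (H (M + e / 4) _) _; first by rewrite lte_fin ltrDl divr_gt0.
  by rewrite -!EFinM -EFinD lee_fin; lra.
- by rewrite gt0_muley ?leey.
- by [].
Qed.

(** On a set of finite measure the L^p norm is bounded by the L^alpha norm: the
    modular of g / (L t) is at most (mu E + int |g / t|^alpha) / L by
    [powR_div_le]. *)
Lemma var_norm_cut_le (E : set V) g (t L : R) :
  measurable (E : set Rn) -> measurable_C g -> 0 < t -> 1 <= L ->
  (mu E + \int[mu]_(x in [set: Rn])
     ((modulus (cut g E x) / t) `^ alpha)%:E <= L%:E)%E ->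
  (var_norm p (cut g E) <= (L * t)%:E)%E.
Proof.
move=> mE mg t0 L1 HL.
have L0 : 0 < L by exact: lt_le_trans L1.
have Lt0 : 0 < L * t by rewrite mulr_gt0.
have mc := measurable_C_cut mE mg.
apply: ereal_inf_lbound; exists (L * t) => //=; split=> //.
have mI : measurable_fun [set: Rn] ((fun x => (\1_E x)%:E) : Rn -> \bar R).
  by apply/measurable_EFinP; exact: measurable_indic.
have mA : measurable_fun [set: Rn]
    ((fun x => ((modulus (cut g E x) / t) `^ alpha)%:E) : Rn -> \bar R).
  apply/measurable_EFinP; apply: measurable_powR_fun; last exact: measurable_cst.
  by apply: measurable_funM; [exact: measurable_modulus|exact: measurable_cst].
apply: (@le_trans _ _ (\int[mu]_(x in [set: Rn]) (L^-1%:E *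
   ((\1_E x)%:E + ((modulus (cut g E x) / t) `^ alpha)%:E)))%E).
  apply: ae_le_integralT.
  - by move=> x; rewrite lee_fin powR_ge0.
  - move=> x; rewrite -EFinD -EFinM lee_fin mulr_ge0 ?invr_ge0 ?(ltW L0)//.
    by rewrite addr_ge0 ?powR_ge0.
  - exact: measurable_modular_integrand (measurable_C_div _ mc).
  - by apply: measurable_funeM; exact: emeasurable_funD.
  - apply: filterS ae_exponent => x /andP[p1x pax].
    rewrite -EFinD -EFinM lee_fin modulus_div// indicE.
    rewrite (_ : modulus _ / _ = modulus (cut g E x) / t / L); last first.
      by rewrite invfM; ring.
    have [xE|xE] := boolP (x \in E).
      by apply: powR_div_le => //; rewrite divr_ge0 ?modulus_ge0 ?(ltW t0).
    rewrite /cut (negbTE xE) modulus0 !mul0r !powR0 ?addr0 ?mulr0//.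
      by rewrite gt_eqF// (lt_le_trans _ (le_trans p1x pax)).
    by rewrite gt_eqF// (lt_le_trans _ p1x).
rewrite ge0_integralZl_EFin;
  [|exact: measurableT|..|by rewrite invr_ge0 ltW]; last 2 first.
- by move=> x _; rewrite -EFinD lee_fin addr_ge0 ?powR_ge0.
- exact: emeasurable_funD.
rewrite ge0_integralD; [|exact: measurableT|..]; last 4 first.
- by move=> x _; rewrite lee_fin.
- exact: mI.
- by move=> x _; rewrite lee_fin powR_ge0.
- exact: mA.
rewrite integral_indic; [|exact: measurableT|exact: mE].
rewrite setIT; apply: (@le_trans _ _ (L^-1%:E * L%:E)%E).
  by apply: lee_wpmul2l; [rewrite lee_fin invr_ge0 ltW|exact: HL].
by rewrite -EFinM mulVf ?gt_eqF.
Qed.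

End VarNorm.

(** * Fofana norms are controlled by Lebesgue norms *)

Lemma esum_integral_le d (T : measurableType d) (R : realType)
    (mu : {measure set T -> \bar R}) (I : choiceType) (F : I -> T -> \bar R)
    (G : T -> \bar R) :
  (forall k x, 0 <= F k x)%E -> (forall k, measurable_fun [set: T] (F k)) ->
  measurable_fun [set: T] G ->
  (forall s x, uniq s -> \sum_(k <- s) F k x <= G x)%E ->
  (\esum_(k in [set: I]) \int[mu]_(x in [set: T]) F k x <=
   \int[mu]_(x in [set: T]) G x)%E.
Proof.
move=> F0 mF mG FG; apply: ge_ereal_sup => _ [A [finA _] <-].
rewrite fsbig_finite//= -(ge0_integral_sum mu measurableT mF (fun k x _ => F0 k x)).
apply: le_integralT => //; first by move=> x; exact: sume_ge0.
- exact: emeasurable_sum.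
- by move=> x; exact: FG.
Qed.

Section FofanaNorm.
Context {R : realType} {d : nat}.
Local Notation V := 'rV[R]_d.+1.
Local Notation Rn := (lebesgueRn R d).
Local Notation mu := (lebesgueRn_measure R d).
Variables (p : V -> \bar R) (alpha : R) (q : \bar R).
Hypothesis mp : measurable_fun [set: Rn] (p : Rn -> \bar R).
Hypothesis p1 : forall x, (1 <= p x)%E.
Hypothesis palpha : {ae mu, forall x, (p x <= alpha%:E)%E}.
Hypothesis alphaq : (alpha%:E <= q)%E.
Implicit Types f g h : V -> R[i].

Let alpha1 : 1 <= alpha := alpha_ge1 p1 palpha.
Let alpha0 : 0 < alpha := lt_le_trans ltr01 alpha1.
Let q1 : (1 <= q)%E.
Proof. by apply: le_trans alphaq; rewrite lee_fin. Qed.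

Lemma measurable_cube (r : R) (k : 'rV[int]_d.+1) : measurable (cube r k : set Rn).
Proof. exact: measurable_box. Qed.

Lemma lebesgue_unit_cube (k : 'rV[int]_d.+1) : (mu (cube 1 k) <= 1)%E.
Proof.
apply: le_trans (lebesgue_box_le _) _ => /= [i|].
  by rewrite !mxE !mul1r ler_int lerDl.
rewrite lee_fin /box_volume /= big1// => i _.
by rewrite !mxE !mul1r rmorphD/= addrAC subrr add0r.
Qed.

(** Disjointness of the unit cubes: a point determines the cube containing it. *)
Lemma unit_cube_floor (k : 'rV[int]_d.+1) (x : V) :
  cube 1 k x -> k = \row_j Num.floor (x ord0 j).
Proof.
move=> kx; apply/rowP => j; rewrite mxE; apply/esym/floor_def.
by have := kx j; rewrite !mxE !mul1r.
Qed.

Lemma fofana_norm_le f (c : R) : (fofana_norm p q alpha f <= c%:E)%E <->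
  forall rho, 0 < rho ->
    (amalgam_norm p q (dilation alpha rho f) <= c%:E)%E.
Proof.
split=> [H rho rho0|H].
  by apply: le_trans H; apply: ereal_sup_ubound; exists rho.
by apply: ge_ereal_sup => _ [rho rho0 <-]; exact: H.
Qed.

Lemma fofana_norm_quasi_triangle f g h (c : R) : 0 <= c ->
  measurable_C f -> measurable_C g -> measurable_C h ->
  {ae mu, forall x, modulus (h x) <= modulus (f x) + modulus (g x)} ->
  (fofana_norm p q alpha f <= c%:E)%E -> (fofana_norm p q alpha g <= c%:E)%E ->
  (fofana_norm p q alpha h <= (8 * c)%:E)%E.
Proof.
move=> c0 mf mg mh hfg /fofana_norm_le Hf /fofana_norm_le Hg.
apply/fofana_norm_le => rho rho0.
apply: (lq_norm_quasi_triangle q1 c0 _ _ _ _ (Hf _ rho0) (Hg _ rho0)).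
- by move=> k; exact: var_norm_ge0.
- by move=> k; exact: var_norm_ge0.
- by move=> k; exact: var_norm_ge0.
move=> k; have mk := measurable_cube 1 k.
apply: (var_norm_quasi_triangle mp p1 palpha).
- exact: measurable_C_cut mk (measurable_C_dilation _ rho0 mf).
- exact: measurable_C_cut mk (measurable_C_dilation _ rho0 mg).
- exact: measurable_C_cut mk (measurable_C_dilation _ rho0 mh).
have r0 : 0 < rho^-1 by rewrite invr_gt0.
apply: filterS (ae_dilation r0 hfg) => x hx.
rewrite /cut; case: ifP => _; last by rewrite modulus0 addr0.
by rewrite /dilation !modulusM -mulrDr ler_wpM2l// modulus_ge0.
Qed.

(** The normalisation rho^(- d / alpha) of [dilation] makes it an isometry of
    L^alpha. *)
Lemma integral_modulus_dilation f (rho : R) : 0 < rho -> measurable_C f ->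
  (\int[mu]_(x in [set: Rn]) (modulus (dilation alpha rho f x) `^ alpha)%:E =
   \int[mu]_(x in [set: Rn]) (modulus (f x) `^ alpha)%:E)%E.
Proof.
move=> rho0 mf; have r0 : 0 < rho^-1 by rewrite invr_gt0.
have mF : measurable_fun [set: Rn]
    ((fun x => (modulus (f x) `^ alpha)%:E) : Rn -> \bar R).
  exact: measurable_modulus_powR.
have F0 x : (0 <= (modulus (f x) `^ alpha)%:E)%E by rewrite lee_fin powR_ge0.
pose F x := ((rho `^ - d.+1%:R)%:E * (modulus (f x) `^ alpha)%:E)%E.
transitivity (\int[mu]_(x in [set: Rn]) F (rho^-1 *: x))%E.
  apply: eq_integral => x _; rewrite /F /dilation modulusM modulus_real.
  rewrite ger0_norm ?powR_ge0// powRM ?powR_ge0 ?modulus_ge0// -powRrM EFinM.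
  by rewrite mulNr divfK ?gt_eqF.
rewrite (integral_dilation r0); last 2 first.
- exact: measurable_funeM.
- by move=> x; rewrite mule_ge0 ?lee_fin ?powR_ge0.
rewrite ge0_integralZl_EFin; [|exact: measurableT|..]; last 3 first.
- by move=> x _.
- exact: mF.
- exact: powR_ge0.
rewrite muleA -EFinM powRN powR_mulrn ?(ltW rho0)// exprVn invrK mulfV ?mul1e//.
by rewrite expf_eq0 gt_eqF.
Qed.

(** Let a_k be the integral of |g|^alpha over the k-th unit cube, where g is a
    dilate of h, and u_k the local norm. Then u_k <= 2 a_k^(1 / alpha) by
    [var_norm_cut_le], the sum of the a_k is at most A^alpha, and
    a_k^(r / alpha) <= A^(r - alpha) a_k for r >= alpha because a_k <= A^alpha. *)
Lemma fofana_norm_le_integral h (A : R) : 0 < A -> measurable_C h ->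
  (\int[mu]_(x in [set: Rn]) (modulus (h x) `^ alpha)%:E <=
   (A `^ alpha)%:E)%E ->
  (fofana_norm p q alpha h <= (2 * A)%:E)%E.
Proof.
move=> A0 mh HA; apply/fofana_norm_le => rho rho0.
rewrite -(integral_modulus_dilation rho0 mh) in HA.
set g := dilation alpha rho h in HA *.
have mg : measurable_C g by exact: measurable_C_dilation.
pose F k x := ((modulus (cut g (cube 1 k) x)) `^ alpha)%:E.
have F0 k x : (0 <= F k x)%E by rewrite lee_fin powR_ge0.
have mF k : measurable_fun [set: Rn] (F k : Rn -> \bar R).
  apply: measurable_modulus_powR.
  exact: measurable_C_cut (measurable_cube _ _) mg.
have mG : measurable_fun [set: Rn]
    ((fun x => (modulus (g x) `^ alpha)%:E) : Rn -> \bar R).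
  exact: measurable_modulus_powR.
pose a k := (\int[mu]_(x in [set: Rn]) F k x)%E.
have a0 k : (0 <= a k)%E by apply: integral_ge0 => x _.
have sum_a : (\esum_(k in [set: 'rV[int]_d.+1]) a k <= (A `^ alpha)%:E)%E.
  apply: le_trans HA; apply: esum_integral_le => // s x us.
  have Fout k : k != \row_j Num.floor (x ord0 j) -> F k x = 0%E.
    move=> kx; rewrite /F /cut; case: ifPn => [|_].
      by rewrite inE => /unit_cube_floor kE; rewrite kE eqxx in kx.
    by rewrite modulus0 powR0// gt_eqF.
  have Fle k : (F k x <= (modulus (g x) `^ alpha)%:E)%E.
    rewrite /F /cut; case: ifPn => // _; rewrite lee_fin.
    by rewrite modulus0 powR0 ?powR_ge0// gt_eqF.
  have [xs|xs] := boolP (\row_j Num.floor (x ord0 j) \in s).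
    rewrite (bigD1_seq _ xs us)/= big1 ?adde0//.
  rewrite big1_seq ?lee_fin ?powR_ge0// => k /= ks.
  by apply: Fout; apply: contraNneq xs => <-.
have a_le k : (a k <= (A `^ alpha)%:E)%E.
  apply: le_trans sum_a; apply: esum_ge; exists [set k]; first by split.
  by rewrite fsbig_set1.
pose u k := var_norm p (cut g (cube 1 k)).
have u0 k : (0 <= u k)%E by exact: var_norm_ge0.
have u_le k (t : R) : 0 < t -> (a k <= (t `^ alpha)%:E)%E ->
    (u k <= (2 * t)%:E)%E.
  move=> t0 akt; apply: (var_norm_cut_le mp p1 palpha) => //.
  - exact: measurable_cube.
  - by rewrite ler1n.
  rewrite (_ : 2%:E = 1 + 1)%E; last by rewrite -EFinD.
  apply: leeD; first exact: lebesgue_unit_cube.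
  have ta0 : 0 < t `^ alpha by rewrite powR_gt0.
  rewrite (eq_integral (fun x : Rn => ((t `^ alpha)^-1)%:E * F k x)%E); last first.
    move=> x _; rewrite /F -EFinM; congr EFin.
    rewrite powRM ?modulus_ge0 ?invr_ge0 ?(ltW t0)// mulrC.
    by rewrite -powR_inv1 ?(ltW t0)// -powRrM mulN1r powRN.
  rewrite ge0_integralZl_EFin; [|exact: measurableT|..]; last 3 first.
  - by move=> x _.
  - exact: mF.
  - by rewrite invr_ge0 ltW.
  by rewrite lee_pdivrMl// mule1.
have A20 : 0 <= 2 * A by rewrite mulr_ge0 ?(ltW A0).
apply/(lq_norm_le_powP q1 A20 u0).
case: q alphaq => [r||] ar; [|by move=> k; exact: u_le k A A0 (a_le k)|by []].
rewrite lee_fin in ar; have r0 : 0 < r by exact: lt_le_trans ar.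
(* u_k^r <= C a_k, and C A^alpha = (2 A)^r *)
pose C := 2 `^ r * A `^ (r - alpha).
have C0 : 0 <= C by rewrite mulr_ge0 ?powR_ge0.
apply: (@le_trans _ _ (\esum_(k in [set: 'rV[int]_d.+1]) (C%:E * a k))%E); last first.
  apply: le_trans (esumZl_le _ C0 a0) _.
  apply: (@le_trans _ _ (C%:E * (A `^ alpha)%:E)%E).
    by apply: lee_wpmul2l; rewrite ?lee_fin.
  rewrite -EFinM lee_fin /C -mulrA -powRD ?subrK; last by rewrite gt_eqF ?implybT.
  by rewrite powRM// ltW.
apply: le_esum => k _.
have : a k \is a fin_num by rewrite ge0_fin_numE// (le_lt_trans (a_le k))// ltry.
have := a_le k; have := a0 k; have := u_le k.
case: (a k) => // {}b Hu; rewrite !lee_fin => b0 bA _.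
(* if a_k = 0, the bound u_k <= 2 t holds for all t > 0, so u_k = 0 *)
have [b_eq0|b_neq0] := eqVneq b 0.
  have : (u k <= 0)%E.
    apply/lee_addgt0Pr => e e0; rewrite add0e.
    apply: le_trans (Hu (e / 2) _ _) _; rewrite ?divr_gt0//.
      by rewrite b_eq0 lee_fin powR_ge0.
    by rewrite lee_fin mulrCA divff ?mulr1.
  move=> uk0; have -> : u k = 0%E by apply/eqP; rewrite eq_le uk0 u0.
  by rewrite poweR0r ?gt_eqF// -EFinM lee_fin mulr_ge0.
have b_gt0 : 0 < b by rewrite lt_neqAle eq_sym b_neq0.
have t0 : 0 < b `^ alpha^-1 by rewrite powR_gt0.
have ta : (b `^ alpha^-1) `^ alpha = b by rewrite -powRrM mulVf ?gt_eqF// powRr1.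
have := Hu _ t0; rewrite ta lexx => /(_ isT) uk.
have := gt0_ler_poweR (ltW r0) _ _ uk.
rewrite !in_itv/= !leey !andbT u0 lee_fin mulr_ge0 ?(ltW t0)// => /(_ isT isT).
move=> /le_trans; apply; rewrite lee_fin /C powRM ?(ltW t0)// -mulrA.
apply: ler_wpM2l; first exact: powR_ge0.
rewrite (_ : (b `^ alpha^-1) `^ r = (b `^ alpha^-1) `^ (r - alpha) * b); last first.
  by rewrite -[X in _ = _ * X]ta -powRD ?subrK// gt_eqF ?implybT.
apply: ler_wpM2r => //; apply: ge0_ler_powR;
  rewrite ?nnegrE ?subr_ge0 ?(ltW t0) ?(ltW A0)//.
have := ge0_ler_powR (r := alpha^-1).
rewrite invr_ge0 (ltW alpha0) => /(_ isT b (A `^ alpha)).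
rewrite !nnegrE b0 powR_ge0 => /(_ isT isT bA).
by rewrite -powRrM mulfV ?gt_eqF// powRr1// ltW.
Qed.

End FofanaNorm.

(** * Smooth functions built from exp(-1/t) *)

Section Bump.
Context {R : realType}.
Implicit Types (P : {poly R}) (t : R).

(** The polynomial factor in 1 / t makes the class stable under
    differentiation. *)
Definition poly_bump P t : R :=
  if 0 < t then P.[t^-1] * expR (- t^-1) else 0.

(** With s = 1 / t, use s^n / n! <= e^s for each monomial. *)
Lemma poly_bump_bounded P : exists C, forall t, `|poly_bump P t| <= C.
Proof.
exists (\sum_(i < size P) `|P`_i| * (i`!)%:R) => t; rewrite /poly_bump.
case: ifP => t0; last by rewrite normr0 sumr_ge0// => i _; rewrite mulr_ge0.
have s0 : 0 < t^-1 by rewrite invr_gt0.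
rewrite horner_coef mulr_suml.
apply: le_trans (ler_norm_sum _ _ _) _; apply: ler_sum => i _.
rewrite !normrM -mulrA ler_wpM2l// normrX !gtr0_norm ?expR_gt0//.
rewrite expRN ler_pdivrMr ?expR_gt0//.
have fi0 : 0 < (i`!)%:R :> R by rewrite ltr0n fact_gt0.
case: (nat_of_ord i) fi0 => [|n] fi0.
  rewrite expr0 fact0 mul1r; have := expR_ge1Dx t^-1; lra.
rewrite -ler_pdivrMl// mulrC.
by apply: le_trans (expR_ge1Dxn n (ltW s0)); rewrite lerDr.
Qed.

(** Away from 0 this is the usual computation. At 0, the difference quotient
    P(1/h) e^(-1/h) / h equals h times the bump of P X^2, which is bounded. *)
Lemma is_derive_poly_bump P t :
  is_derive t 1 (poly_bump P) (poly_bump ('X^2 * (P - P^`())) t).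
Proof.
have [t0|t0|->] := ltgtP t 0.
- rewrite {2}/poly_bump ltNge (ltW t0)/=.
  apply: (@near_eq_is_derive _ _ _ (cst 0)).
  near=> s; rewrite /poly_bump ltNge (_ : s <= 0)//; apply: ltW.
  by near: s; exact: lt_nbhsl.
- rewrite {2}/poly_bump t0.
  pose g s : R := P.[s^-1] * expR (- s^-1).
  apply: (@near_eq_is_derive _ _ _ g).
    near=> s; rewrite /poly_bump /g ifT//.
    by near: s; exact: lt_nbhsr.
  have dV : is_derive t 1 (fun s : R => s^-1) (- t^-2).
    apply: (@is_derive_eq _ _ _ _ _ _ _ _ (@is_deriveV R id t 1 1 _ _)).
      by rewrite gt_eqF.
    by rewrite /GRing.scale/= mulr1.
  have d1 : is_derive t 1 (fun s => P.[s^-1]) (P^`().[t^-1] * - t^-2).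
    exact: (@is_derive1_comp R (horner P) (fun s => s^-1) t).
  have d2 : is_derive t 1 (fun s => expR (- s^-1)) (expR (- t^-1) * t^-2).
    have dN : is_derive t 1 (fun s : R => - s^-1) (t^-2).
      by apply: (is_derive_eq (is_deriveN dV)); rewrite opprK.
    exact: (@is_derive1_comp R expR (fun s => - s^-1) t).
  apply: (is_derive_eq (is_deriveM d1 d2)).
  rewrite /GRing.scale/= !hornerE/= exprVn; ring.
- have [C HC] := poly_bump_bounded (P * 'X^2).
  have C0 : 0 <= C by exact: le_trans (HC 0).
  rewrite {2}/poly_bump ltxx.
  have lim0 : (fun h => h^-1 *: ((poly_bump P \o shift 0) (h *: 1) - poly_bump P 0))
      @ (0 : R)^' --> (0 : R).
    apply/cvgr0Pnorm_lt => e e0.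
    have eC : 0 < e / (C + 1) by rewrite divr_gt0// ltr_wpDl.
    near=> h.
    have h0 : h != 0 by near: h; exact: nbhs_dnbhs_neq.
    have he : `|h| < e / (C + 1).
      by near: h; apply: dnbhs0_lt.
    rewrite {2}/poly_bump ltxx subr0 /= addr0 /GRing.scale/= mulr1.
    have -> : h^-1 * poly_bump P h = h * poly_bump (P * 'X^2) h.
      rewrite /poly_bump; case: ifP => _; rewrite ?mulr0//.
      by rewrite !hornerE/=; field.
    rewrite normrM.
    apply: (@le_lt_trans _ _ (`|h| * (C + 1))).
      by rewrite ler_wpM2l// (le_trans (HC h))// lerDl.
    by rewrite -ltr_pdivlMr// ltr_wpDl.
  apply: DeriveDef; first by apply/cvg_ex; exists 0.
  exact/cvg_lim.
Unshelve. all: by end_near. Qed.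

Lemma continuous_poly_bump P : continuous (poly_bump P).
Proof.
move=> t; apply: differentiable_continuous; apply/derivable1_diffP.
by have [] := is_derive_poly_bump P t.
Qed.

End Bump.

Section SmoothRn.
Context {R : realType} {d : nat}.
Local Notation V := 'rV[R]_d.+1.
Implicit Types f g : V -> R.

Lemma C_k_continuous k f : C_k k f -> continuous f.
Proof. by case: k => [|k] []. Qed.

Lemma C_kS k f : C_k k.+1 f -> C_k k f.
Proof.
elim: k f => [|k IH] f [cf Hf]; split=> // i.
by have [df Cdf] := Hf i; split=> //; exact: IH.
Qed.

Lemma C_k_cst k (c : R) : C_k k (fun _ : V => c).
Proof.
have cc c' : continuous (fun _ : V => c' : R) by exact: cst_continuous.
elim: k c => [|k IH] c; split; try exact: cc; try exact: I.
move=> i; split; first by move=> x; exact: derivable_cst.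
have -> : (fun x : V => 'D_(delta_mx ord0 i) (fun=> c) x) = (fun=> 0).
  by apply/funext => x; rewrite derive_cst.
exact: IH.
Qed.

Lemma C_kD k f g : C_k k f -> C_k k g -> C_k k (fun x => f x + g x).
Proof.
elim: k f g => [|k IH] f g [cf Hf] [cg Hg];
  (split; first by move=> x; exact: (cvgD (cf x) (cg x))); first by [].
move=> i; have [df Cf] := Hf i; have [dg Cg] := Hg i; split.
  by move=> x; exact: derivableD.
have -> : (fun x => 'D_(delta_mx ord0 i) (fun y => f y + g y) x) =
    (fun x => 'D_(delta_mx ord0 i) f x + 'D_(delta_mx ord0 i) g x).
  by apply/funext => x; rewrite -deriveD.
exact: IH.
Qed.

Lemma C_kM k f g : C_k k f -> C_k k g -> C_k k (fun x => f x * g x).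
Proof.
elim: k f g => [|k IH] f g [cf Hf] [cg Hg];
  (split; first by move=> x; exact: (cvgM (cf x) (cg x))); first by [].
move=> i; have [df Cf] := Hf i; have [dg Cg] := Hg i; split.
  by move=> x; exact: derivableM.
have -> : (fun x => 'D_(delta_mx ord0 i) (fun y => f y * g y) x) =
    (fun x => f x * 'D_(delta_mx ord0 i) g x + g x * 'D_(delta_mx ord0 i) f x).
  by apply/funext => x; rewrite -[LHS]/('D_(delta_mx ord0 i) (f * g) x) deriveM.
by apply: C_kD; apply: IH => //; apply: C_kS; split.
Qed.

Lemma C_k_prod k (I : Type) (s : seq I) (F : I -> V -> R) :
  (forall i, C_k k (F i)) -> C_k k (fun x => \prod_(i <- s) F i x).
Proof.
move=> CF; elim: s => [|i s IH].
  have -> : (fun x => \prod_(i <- [::]) F i x) = (fun=> 1).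
    by apply/funext => x; rewrite big_nil.
  exact: C_k_cst.
have -> : (fun x => \prod_(j <- i :: s) F j x) =
    (fun x => F i x * \prod_(j <- s) F j x).
  by apply/funext => x; rewrite big_cons.
exact: C_kM.
Qed.

Lemma is_derive_coord (phi : R -> R) (l : R) (i j : 'I_d.+1) (x : V) :
  is_derive (x ord0 i) 1 phi l ->
  is_derive x (delta_mx ord0 j) (fun y : V => phi (y ord0 i)) (l *+ (i == j)).
Proof.
move=> dphi.
case: eqVneq => [<-|ij].
  have E : (fun h : R => h^-1 *: (((fun y : V => phi (y ord0 i)) \o shift x)
        (h *: delta_mx ord0 i) - phi (x ord0 i))) =
      (fun h : R => h^-1 *: ((phi \o shift (x ord0 i)) (h *: (1 : R)) -
        phi (x ord0 i))).
    by apply/funext => h /=; rewrite !mxE !eqxx.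
  case: dphi => dphi lE; apply: DeriveDef.
    by rewrite /derivable E.
  by rewrite /derive E.
rewrite mulr0n.
have E : (fun h : R => h^-1 *: (((fun y : V => phi (y ord0 i)) \o shift x)
    (h *: delta_mx ord0 j) - phi (x ord0 i))) = cst 0.
  by apply/funext => h /=; rewrite !mxE (negbTE ij) andbF mulr0 add0r subrr scaler0.
apply: DeriveDef; first by rewrite /derivable E; exact: is_cvg_cst.
by rewrite /derive E; apply: cvg_lim => //; exact: cvg_cst.
Qed.

(** By induction on k for all P at once, as derivatives are again bumps. *)
Lemma C_k_poly_bump k (P : {poly R}) (a b : R) (i : 'I_d.+1) :
  C_k k (fun x : V => poly_bump P (a * x ord0 i + b)).
Proof.
elim: k P => [|k IH] P.
  split; last by [].
  move=> x.
  apply: (@continuous_comp _ _ _ (fun x : V => a * x ord0 i + b) (poly_bump P)).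
    have ci : (fun y : V => y ord0 i) @ x --> x ord0 i.
      exact: (@coord_continuous R 1 d.+1 ord0 i x).
    have ca : (fun y : V => a * y ord0 i) @ x --> a * x ord0 i.
      exact: (cvgMl_tmp ci).
    have cb : (fun _ : V => b) @ x --> b by exact: cst_continuous.
    exact: (cvgD ca cb).
  exact: continuous_poly_bump.
split; first exact: (C_k_continuous (IH P)).
move=> j.
pose Q := 'X^2 * (P - P^`()).
have dj (x : V) : is_derive x (delta_mx ord0 j)
    (fun x : V => poly_bump P (a * x ord0 i + b))
    ((poly_bump Q (a * x ord0 i + b) * a) *+ (i == j)).
  apply: (@is_derive_coord (fun t => poly_bump P (a * t + b))).
  have daff : is_derive (x ord0 i) 1 (fun t => a * t + b) a.
    apply: (@is_derive_eq _ _ _ _ _ _ _ _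
      (@is_deriveD _ _ _ (a \*: id) (cst b) (x ord0 i) 1 (a *: 1) 0 _ _)).
    by rewrite addr0 /GRing.scale/= mulr1.
  apply: (@is_derive1_comp R (poly_bump P) (fun t => a * t + b)).
  exact: is_derive_poly_bump.
split; first by move=> x; have [] := dj x.
have -> : (fun x : V =>
      'D_(delta_mx ord0 j) (fun x : V => poly_bump P (a * x ord0 i + b)) x) =
    (fun x => (a *+ (i == j)) * poly_bump Q (a * x ord0 i + b)).
  by apply/funext => x; have [_ ->] := dj x; rewrite mulrnAl mulrC.
by apply: C_kM; [exact: C_k_cst|exact: IH].
Qed.

End SmoothRn.

(** * Integrals of powers: dominated convergence and quasi-additivity *)

Section PowerIntegrals.
Context d (T : measurableType d) (R : realType) (mu : {measure set T -> \bar R}).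
Variable a : R.
Hypothesis a1 : 1 <= a.
Implicit Types f g h : T -> R.

Let a0 : 0 < a := lt_le_trans ltr01 a1.

Lemma measurable_powR_norm f : measurable_fun [set: T] f ->
  measurable_fun [set: T] (fun x => (`|f x| `^ a)%:E).
Proof.
move=> mf; apply/measurable_EFinP; apply: measurable_powR_fun => //.
exact: measurableT_comp.
Qed.

Lemma cvg_powR0 (u : nat -> R) : u @ \oo --> 0 ->
  (`|u n| `^ a) @[n --> \oo] --> (0 : R).
Proof.
move=> u0; apply/cvgr0Pnorm_lt => e e0.
have ea0 : 0 < e `^ a^-1 by rewrite powR_gt0.
move/cvgr0Pnorm_lt : u0 => /(_ _ ea0) H.
near=> n; rewrite ger0_norm ?powR_ge0//.
have -> : e = (e `^ a^-1) `^ a.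
  by rewrite -powRrM mulVf ?gt_eqF// powRr1// ltW.
apply: gt0_ltr_powR => //; rewrite ?nnegrE ?powR_ge0//.
by near: n.
Unshelve. all: by end_near. Qed.

(** The limit inherits the domination |f| <= G, so |f_n - f|^a is dominated by
    the integrable function (2 G)^a. *)
Lemma dominated_powR_cvg (f_ : nat -> T -> R) f G :
  (forall n, measurable_fun [set: T] (f_ n)) -> measurable_fun [set: T] f ->
  measurable_fun [set: T] G ->
  {ae mu, forall x, f_ n x @[n --> \oo] --> f x} ->
  {ae mu, forall x, forall n, `|f_ n x| <= G x} ->
  (\int[mu]_(x in [set: T]) (`|G x| `^ a)%:E < +oo)%E ->
  (\int[mu]_(x in [set: T]) (`|f_ n x - f x| `^ a)%:E)%E @[n --> \oo] --> 0%E.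
Proof.
move=> mf_ mf mG f_f f_G Goo.
have mH n : measurable_fun [set: T] (fun x => (`|f_ n x - f x| `^ a)%:E).
  by apply: measurable_powR_norm; exact: measurable_funB.
have mGG : measurable_fun [set: T] (fun x => (`|2 * G x| `^ a)%:E).
  by apply: measurable_powR_norm; exact: measurable_funM.
have f_f0 : {ae mu, forall x, [set: T] x ->
    (`|f_ n x - f x| `^ a)%:E @[n --> \oo] --> (cst 0%E x : \bar R)}.
  apply: filterS f_f => x fx _; apply: cvg_EFin; first by apply: nearW.
  apply: cvg_powR0; rewrite -(subrr (f x)); apply: (cvgB fx); exact: cvg_cst.
have iG : mu.-integrable [set: T] (fun x => (`|2 * G x| `^ a)%:E).
  apply/integrableP; split => //.
  rewrite (eq_integral (fun x => (2 `^ a)%:E * (`|G x| `^ a)%:E)%E); last first.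
    move=> x _; rewrite gee0_abs ?lee_fin ?powR_ge0// normrM powRM//.
    by rewrite ger0_norm// EFinM.
  rewrite ge0_integralZl_EFin ?powR_ge0//; last exact: measurable_powR_norm.
  by rewrite lte_mul_pinfty ?lee_fin ?powR_ge0.
have HG : {ae mu, forall x, forall n, [set: T] x ->
    (`|(`|f_ n x - f x| `^ a)%:E| <= (`|2 * G x| `^ a)%:E)%E}.
  apply: filterS2 f_f f_G => x fx Gx n _.
  rewrite gee0_abs ?lee_fin ?powR_ge0//.
  have fG : `|f x| <= G x.
    have nf : `|f_ n x| @[n --> \oo] --> `|f x| by exact: cvg_norm.
    rewrite -(cvg_lim (@Rhausdorff R) nf); apply: limr_le.
      by apply/cvg_ex; eexists; exact: nf.
    by apply: nearW => m; exact: Gx.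
  have G0 : 0 <= G x by apply: le_trans fG.
  apply: ge0_ler_powR; rewrite ?nnegrE ?(ltW a0)//.
  rewrite [leRHS]ger0_norm ?mulr_ge0//; apply: le_trans (ler_normB _ _) _.
  by have := Gx n; lra.
have [_ _] := dominated_convergence measurableT mH
  (@measurable_cst _ _ _ _ _ 0%E) f_f0 iG HG.
by rewrite integral0.
Qed.

Lemma integral_powRD_le f g h :
  measurable_fun [set: T] f -> measurable_fun [set: T] g ->
  measurable_fun [set: T] h -> (forall x, `|h x| <= `|f x| + `|g x|) ->
  (\int[mu]_(x in [set: T]) (`|h x| `^ a)%:E <= (4 `^ a)%:E *
    (\int[mu]_(x in [set: T]) (`|f x| `^ a)%:E +
     \int[mu]_(x in [set: T]) (`|g x| `^ a)%:E))%E.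
Proof.
move=> mf mg mh hfg.
have mf' := measurable_powR_norm mf; have mg' := measurable_powR_norm mg.
apply: (@le_trans _ _ (\int[mu]_(x in [set: T])
    ((4 `^ a)%:E * ((`|f x| `^ a)%:E + (`|g x| `^ a)%:E)))%E); last first.
  rewrite ge0_integralZl_EFin//; last 2 first.
  - by move=> x _; rewrite adde_ge0// lee_fin powR_ge0.
  - exact: emeasurable_funD.
  by rewrite ge0_integralD.
apply: le_integralT => //; first exact: measurable_powR_norm.
  by apply: measurable_funeM; exact: emeasurable_funD.
move=> x; rewrite -EFinD -EFinM lee_fin.
have := powR_convex_le a1 (normr_ge0 (f x)) (normr_ge0 (g x)) (normr_ge0 (h x)) (hfg x).
rewrite powRM// -powR_inv1// -powRrM mulN1r powRN.
have p4 : 0 < (4 : R) `^ a by rewrite powR_gt0.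
rewrite ler_pdivrMr//; move=> /le_trans; apply.
rewrite mulrC ler_wpM2l ?(ltW p4)//.
have := powR_ge0 `|f x| a; have := powR_ge0 `|g x| a; lra.
Qed.

End PowerIntegrals.

(** * Smooth approximations of indicators of finite unions of boxes *)

Section BumpLimits.
Context {R : realType}.

Lemma poly_bump1_ge0 (t : R) : 0 <= poly_bump 1 t.
Proof. by rewrite /poly_bump; case: ifP => // _; rewrite hornerE mul1r expR_ge0. Qed.

Lemma poly_bump1_le1 (t : R) : poly_bump 1 t <= 1.
Proof.
rewrite /poly_bump; case: ifP => // t0.
by rewrite hornerE mul1r -expR0 ler_expR oppr_le0 invr_ge0 ltW.
Qed.

Lemma poly_bump_eq0 (P : {poly R}) (t : R) : t <= 0 -> poly_bump P t = 0.
Proof. by move=> t0; rewrite /poly_bump ltNge t0. Qed.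

(** exp(-1/t) >= 1 - 1/t. *)
Lemma cvg_poly_bump1 (u : nat -> R) :
  (\forall n \near \oo, n.+1%:R <= u n) ->
  poly_bump 1 (u n) @[n --> \oo] --> (1 : R).
Proof.
move=> Hu.
have l1 : (1 - n.+1%:R^-1 : R) @[n --> \oo] --> (1 : R).
  rewrite -[X in _ --> X]subr0; apply: cvgB; first exact: cvg_cst.
  exact: cvg_harmonic.
apply: (squeeze_cvgr _ l1 (cvg_cst (1 : R))).
near=> n; rewrite poly_bump1_le1 andbT.
have un : n.+1%:R <= u n by near: n.
have n0 : 0 < n.+1%:R :> R by rewrite ltr0n.
have u0 : 0 < u n by exact: lt_le_trans un.
rewrite /poly_bump u0 hornerE mul1r; apply: le_trans (expR_ge1Dx _).
by rewrite lerD2l lerN2 lef_pV2 ?posrE.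
Unshelve. all: by end_near. Qed.

Lemma cvg_prod (I : Type) (s : seq I) (u : I -> nat -> R) (l : I -> R) :
  (forall i, u i n @[n --> \oo] --> l i) ->
  \prod_(i <- s) u i n @[n --> \oo] --> \prod_(i <- s) l i.
Proof.
move=> ul; elim: s => [|i s IH].
  by rewrite big_nil; under eq_fun do rewrite big_nil; exact: cvg_cst.
rewrite big_cons; under eq_fun do rewrite big_cons.
by apply: cvgM; [exact: ul|exact: IH].
Qed.

(** A smooth version of the indicator of [a, b[: the arguments
    N^2 (x - a) + N and N^2 (b - x) - N, with N = n + 1, tend to +oo inside the
    interval, and outside one of them is eventually nonpositive. The shifts by N select the
    half-open interval exactly, so that no boundary has to be discarded. *)
Definition smooth_step (n : nat) (a b x : R) : R :=
  poly_bump 1 (n.+1%:R ^+ 2 * x + (n.+1%:R - n.+1%:R ^+ 2 * a)) *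
  poly_bump 1 (- n.+1%:R ^+ 2 * x + (n.+1%:R ^+ 2 * b - n.+1%:R)).

Lemma smooth_step_cvg (a b x : R) :
  smooth_step n a b x @[n --> \oo] --> ((a <= x < b)%R%:R : R).
Proof.
have big (c : R) : 0 < c -> \forall n \near \oo, 2 <= n.+1%:R * c.
  move=> c0; near=> n; rewrite -ler_pdivrMr//.
  apply: (@le_trans _ _ n%:R); last by rewrite ler_nat.
  by near: n; exact: nbhs_infty_ger.
have [ax|xa] := leP a x; have [xb|bx] := ltP x b => /=.
- rewrite -[X in _ --> X]mulr1; apply: cvgM; apply: cvg_poly_bump1.
    near=> n; have n0 : 0 < n.+1%:R :> R by rewrite ltr0n.
    have : 0 <= n.+1%:R ^+ 2 * (x - a) by rewrite mulr_ge0 ?exprn_ge0 ?subr_ge0.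
    lra.
  near=> n; have n0 : 0 < n.+1%:R :> R by rewrite ltr0n.
  have : 2 <= n.+1%:R * (b - x) by near: n; apply: big; rewrite subr_gt0.
  nra.
- apply: cvg_near_cst; near=> n; have n0 : 0 < n.+1%:R :> R by rewrite ltr0n.
  rewrite /smooth_step (@poly_bump_eq0 _ (_ + (_ - n.+1%:R))) ?mulr0//.
  have : 0 <= n.+1%:R ^+ 2 * (x - b) by rewrite mulr_ge0 ?exprn_ge0 ?subr_ge0.
  lra.
- apply: cvg_near_cst; near=> n; have n0 : 0 < n.+1%:R :> R by rewrite ltr0n.
  rewrite /smooth_step (@poly_bump_eq0 _ (_ + (n.+1%:R - _))) ?mul0r//.
  have : 2 <= n.+1%:R * (a - x) by near: n; apply: big; rewrite subr_gt0.
  nra.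
- apply: cvg_near_cst; near=> n; have n0 : 0 < n.+1%:R :> R by rewrite ltr0n.
  rewrite /smooth_step (@poly_bump_eq0 _ (_ + (_ - n.+1%:R))) ?mulr0//.
  have : 0 <= n.+1%:R ^+ 2 * (x - b) by rewrite mulr_ge0 ?exprn_ge0 ?subr_ge0.
  lra.
Unshelve. all: by end_near. Qed.

Lemma smooth_step_supp (n : nat) (a b x : R) :
  smooth_step n a b x != 0 -> a - 1 <= x < b.
Proof.
have n0 : 0 < n.+1%:R :> R by rewrite ltr0n.
have n1 : 1 <= n.+1%:R :> R by rewrite ler1n.
apply: contraR; rewrite negb_and -ltNge -leNgt => /orP[xa|bx]; apply/eqP.
  rewrite /smooth_step (@poly_bump_eq0 _ (_ + (n.+1%:R - _))) ?mul0r//.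
  have : 0 <= n.+1%:R ^+ 2 * (a - 1 - x) by rewrite mulr_ge0 ?exprn_ge0// subr_ge0 ltW.
  nra.
rewrite /smooth_step (@poly_bump_eq0 _ (_ + (_ - n.+1%:R))) ?mulr0//.
have : 0 <= n.+1%:R ^+ 2 * (x - b) by rewrite mulr_ge0 ?exprn_ge0 ?subr_ge0.
lra.
Qed.

Lemma smooth_step_itv (n : nat) (a b x : R) : 0 <= smooth_step n a b x <= 1.
Proof.
rewrite /smooth_step mulr_ge0 ?poly_bump1_ge0//=.
by rewrite mulr_ile1 ?poly_bump1_ge0 ?poly_bump1_le1.
Qed.

End BumpLimits.

Section TestFunctions.
Context {R : realType} {d : nat}.
Local Notation V := 'rV[R]_d.+1.
Local Notation Rn := (lebesgueRn R d).
Local Notation mu := (lebesgueRn_measure R d).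
Implicit Types f g h s : V -> R.

(** Real test functions, with the support condition in terms of cubes, which is
    convenient for sums. *)
Definition test_function s := (forall k, C_k k s) /\
  exists M : R, forall x, s x != 0 -> box (const_mx (- M), const_mx M) x.

Lemma test_function0 : test_function (fun=> 0).
Proof.
by split=> [k|]; [exact: C_k_cst|exists 0 => x; rewrite eqxx].
Qed.

Lemma box_sub (M M' : R) : M <= M' ->
  box (const_mx (- M) : V, const_mx M) `<=` box (const_mx (- M') : V, const_mx M').
Proof.
move=> MM x Hx i; have := Hx i; rewrite !mxE => /andP[h1 h2].
by rewrite (lt_le_trans h2)// andbT (le_trans _ h1)// lerN2.
Qed.

Lemma test_functionD s1 s2 : test_function s1 -> test_function s2 ->
  test_function (fun x => s1 x + s2 x).
Proof.
move=> [C1 [M1 S1]] [C2 [M2 S2]]; split=> [k|]; first exact: C_kD.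
exists (Num.max M1 M2) => x.
have [s10|s10] := eqVneq (s1 x) 0; last first.
  by move=> _; apply: (box_sub _ (S1 _ s10)); rewrite le_max lexx.
rewrite s10 add0r => s20.
by apply: (box_sub _ (S2 _ s20)); rewrite le_max lexx orbT.
Qed.

Lemma test_functionM s f : test_function s -> (forall k, C_k k f) ->
  test_function (fun x => f x * s x).
Proof.
move=> [Cs [M S]] Cf; split=> [k|]; first exact: C_kM.
by exists M => x; rewrite mulf_eq0 negb_or => /andP[_ /S].
Qed.

Lemma measurable_test_function s : test_function s ->
  measurable_fun [set: Rn] (s : Rn -> R).
Proof. by move=> [/(_ 0%N)[cs _] _]; exact: continuous_measurableRn. Qed.

Definition smooth_box (n : nat) (ab : V * V) (x : V) : R :=
  \prod_(i < d.+1) smooth_step n (ab.1 ord0 i) (ab.2 ord0 i) (x ord0 i).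

Lemma smooth_box_cvg ab x :
  smooth_box n ab x @[n --> \oo] --> (\1_(box ab) x : R).
Proof.
have -> : \1_(box ab) x =
    \prod_(i < d.+1) (ab.1 ord0 i <= x ord0 i < ab.2 ord0 i)%R%:R :> R.
  rewrite indicE; have [xab|xab] := boolP (x \in box ab).
    by rewrite inE in xab; rewrite big1// => i _; rewrite xab.
  have [i Hi] : exists i, ~~ (ab.1 ord0 i <= x ord0 i < ab.2 ord0 i).
    apply/existsP; rewrite -negb_forall; apply: contra xab => /forallP xab.
    by rewrite inE.
  by rewrite (bigD1 i)//= (negbTE Hi) mul0r.
by apply: cvg_prod => i; exact: smooth_step_cvg.
Qed.

Lemma smooth_box_itv n ab x : 0 <= smooth_box n ab x <= 1.
Proof.
rewrite /smooth_box; apply/andP; split.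
  apply: prodr_ge0 => i _.
  by have /andP[] := smooth_step_itv n (ab.1 ord0 i) (ab.2 ord0 i) (x ord0 i).
by apply: Num.Theory.prodr_ile1 => i _; exact: smooth_step_itv.
Qed.

Lemma smooth_box_supp n ab x :
  smooth_box n ab x != 0 -> box (ab.1 - const_mx 1, ab.2) x.
Proof.
move=> /prodf_neq0 H i; rewrite !mxE; exact: smooth_step_supp (H i isT).
Qed.

Lemma C_k_smooth_box k n ab : C_k k (smooth_box n ab).
Proof.
apply: C_k_prod => i; apply: C_kM; exact: C_k_poly_bump.
Qed.

(** The indicator of a union is 1 - prod (1 - indicator); replacing the
    indicators by smooth functions keeps the values in [0, 1]. *)
Definition smooth_union (n : nat) (s : seq (V * V)) (x : V) : R :=
  1 - \prod_(ab <- s) (1 - smooth_box n ab x).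

Lemma smooth_union_cvg (s : seq (V * V)) x :
  smooth_union n s x @[n --> \oo] --> (\1_(\big[setU/set0]_(ab <- s) box ab) x : R).
Proof.
have -> : \1_(\big[setU/set0]_(ab <- s) box ab) x =
    1 - \prod_(ab <- s) (1 - \1_(box ab) x) :> R.
  elim: s => [|ab s IH]; first by rewrite !big_nil subrr indicE in_set0.
  have E : \prod_(ab <- s) (1 - \1_(box ab) x) =
      1 - \1_(\big[setU/set0]_(ab <- s) box ab) x :> R by rewrite IH; ring.
  rewrite !big_cons E !indicE in_setU.
  by case: (x \in box ab); case: (x \in _) => /=; ring.
apply: cvgB; first exact: cvg_cst.
by apply: cvg_prod => ab; apply: cvgB; [exact: cvg_cst|exact: smooth_box_cvg].
Qed.

Lemma smooth_union_itv n (s : seq (V * V)) x : 0 <= smooth_union n s x <= 1.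
Proof.
have H ab : 0 <= 1 - smooth_box n ab x <= 1.
  by have /andP[h0 h1] := smooth_box_itv n ab x; apply/andP; split; lra.
have p0 : 0 <= \prod_(ab <- s) (1 - smooth_box n ab x).
  by apply: prodr_ge0 => ab _; have /andP[] := H ab.
have p1 : \prod_(ab <- s) (1 - smooth_box n ab x) <= 1 by exact: Num.Theory.prodr_ile1.
by rewrite /smooth_union; apply/andP; split; lra.
Qed.

Lemma smooth_union_supp (s : seq (V * V)) : exists M : R, forall n x,
  smooth_union n s x != 0 -> box (const_mx (- M), const_mx M) x.
Proof.
elim: s => [|ab s [M HM]].
  by exists 0 => n x; rewrite /smooth_union big_nil subrr eqxx.
pose M1 := \big[Num.max/M]_i Num.max (1 - ab.1 ord0 i) (ab.2 ord0 i).
exists M1 => n x.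
have [s0|s0] := eqVneq (smooth_union n s x) 0; last first.
  by move=> _; apply: (box_sub _ (HM _ _ s0)); exact: bigmax_ge_id.
have [b0|b0] := eqVneq (smooth_box n ab x) 0.
  by rewrite /smooth_union big_cons b0 subr0 mul1r -/(smooth_union n s x) s0 eqxx.
move=> _ i; have := smooth_box_supp b0 i; rewrite !mxE => /andP[h1 h2].
have := le_bigmax M (fun i => Num.max (1 - ab.1 ord0 i) (ab.2 ord0 i)) i.
rewrite -/M1 ge_max => /andP[m1 m2]; apply/andP; split; lra.
Qed.

Lemma test_function_smooth_union n (s : seq (V * V)) : test_function (smooth_union n s).
Proof.
split=> [k|]; last by have [M HM] := smooth_union_supp s; exists M => x; exact: HM.
have -> : smooth_union n s =
    (fun x => 1 + (-1) * \prod_(ab <- s) (1 + (-1) * smooth_box n ab x)).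
  apply/funext => x; rewrite /smooth_union mulN1r; congr (_ - _).
  by apply: eq_bigr => ab _; rewrite mulN1r.
apply: C_kD; first exact: C_k_cst.
apply: C_kM; first exact: C_k_cst.
apply: C_k_prod => ab; apply: C_kD; first exact: C_k_cst.
by apply: C_kM; [exact: C_k_cst|exact: C_k_smooth_box].
Qed.

End TestFunctions.

(** * Approximation of measurable sets of finite measure *)

Section IndicatorDensity.
Context {R : realType} {d : nat}.
Local Notation V := 'rV[R]_d.+1.
Local Notation Rn := (lebesgueRn R d).
Local Notation mu := (lebesgueRn_measure R d).
Variable a : R.
Hypothesis a1 : 1 <= a.
Implicit Types f g h s : V -> R.

Let a0 : 0 < a := lt_le_trans ltr01 a1.

(** Membership in the L^a closure of the test functions. The a-th power of the
    norm is used, so that only [integral_powRD_le] is needed. *)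
Definition approximable g := measurable_fun [set: Rn] (g : Rn -> R) /\
  forall e : R, 0 < e -> exists2 s, test_function s &
    (\int[mu]_(x in [set: Rn]) (`|g x - s x| `^ a)%:E <= e%:E)%E.

(** Splits an error e in two, accounting for the constant of
    [integral_powRD_le]. *)
Lemma half_budget (e : R) : 0 < e -> exists2 e' : R, 0 < e' &
  forall x y : \bar R, (x <= e'%:E -> y <= e'%:E ->
    (4 `^ a)%:E * (x + y) <= e%:E)%E.
Proof.
move=> e0; have p4 : 0 < (4 : R) `^ a by rewrite powR_gt0.
exists (e / (2 * 4 `^ a)); first by rewrite divr_gt0// mulr_gt0.
move=> x y xe ye.
apply: (@le_trans _ _ ((4 `^ a)%:E *
    ((e / (2 * 4 `^ a))%:E + (e / (2 * 4 `^ a))%:E))%E).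
  by apply: lee_wpmul2l; [rewrite lee_fin ltW|exact: leeD].
rewrite -EFinD -EFinM lee_fin le_eqVlt; apply/orP; left; apply/eqP.
by field; rewrite gt_eqF.
Qed.

(** The closure is closed. *)
Lemma approximable_lim g : measurable_fun [set: Rn] (g : Rn -> R) ->
  (forall e : R, 0 < e -> exists2 g', approximable g' &
    (\int[mu]_(x in [set: Rn]) (`|g x - g' x| `^ a)%:E <= e%:E)%E) ->
  approximable g.
Proof.
move=> mg H; split=> // e e0.
have [e' e'0 He] := half_budget e0.
have [g' [mg' Hg'] gg'] := H _ e'0; have [s ts gs] := Hg' _ e'0.
exists s => //; have ms := measurable_test_function ts.
apply: le_trans (He _ _ gg' gs).
apply: (@integral_powRD_le _ Rn R mu a a1
  (fun x : Rn => g x - g' x)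
  (fun x : Rn => g' x - s x) (fun x : Rn => g x - s x)).
- exact: measurable_funB.
- exact: measurable_funB.
- exact: measurable_funB.
- move=> x; apply: le_trans (ler_normD _ _).
  by rewrite (_ : g x - s x = g x - g' x + (g' x - s x))//; ring.
Qed.

Lemma approximable_cvg (g_ : nat -> V -> R) g G :
  (forall n, approximable (g_ n)) ->
  measurable_fun [set: Rn] (g : Rn -> R) ->
  measurable_fun [set: Rn] (G : Rn -> R) ->
  (forall x, g_ n x @[n --> \oo] --> g x) ->
  (forall n x, `|g_ n x| <= G x) ->
  (\int[mu]_(x in [set: Rn]) (`|G x| `^ a)%:E < +oo)%E ->
  approximable g.
Proof.
move=> Ag mg mG g_g g_G Goo; apply: approximable_lim => // e e0.
have ae_g : {ae mu, forall x, g_ n x @[n --> \oo] --> g x}.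
  by apply: aeW => x; exact: g_g.
have ae_G : {ae mu, forall x, forall n, `|g_ n x| <= G x}.
  by apply: aeW => x n; exact: g_G.
have := @dominated_powR_cvg _ Rn R mu a a1 g_ g G
  (fun n => (Ag n).1) mg mG ae_g ae_G Goo.
move=> /fine_cvgP[Hfin /cvgr0Pnorm_le /(_ _ e0) Hlim].
have : \forall n \near \oo,
    (\int[mu]_(x in [set: Rn]) (`|g x - g_ n x| `^ a)%:E <= e%:E)%E.
  near=> n.
  rewrite (eq_integral (fun x : Rn => (`|g_ n x - g x| `^ a)%:E)); last first.
    by move=> x _; rewrite distrC.
  rewrite -[leLHS]fineK; last by near: n.
  rewrite lee_fin; apply: le_trans (ler_norm _) _.
  by near: n.
by case=> N _ /(_ N (leqnn N)) HN; exists (g_ N).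
Unshelve. all: by end_near. Qed.

Lemma approximableD g1 g2 : approximable g1 -> approximable g2 ->
  approximable (fun x => g1 x + g2 x).
Proof.
move=> [mg1 H1] [mg2 H2]; split=> [|e e0]; first exact: measurable_funD.
have [e' e'0 He] := half_budget e0.
have [s1 t1 g1s] := H1 _ e'0; have [s2 t2 g2s] := H2 _ e'0.
have ms1 := measurable_test_function t1; have ms2 := measurable_test_function t2.
exists (fun x => s1 x + s2 x); first exact: test_functionD.
apply: le_trans (He _ _ g1s g2s).
apply: (@integral_powRD_le _ Rn R mu a a1
  (fun x : Rn => g1 x - s1 x)
  (fun x : Rn => g2 x - s2 x)
  (fun x : Rn => g1 x + g2 x - (s1 x + s2 x))).
- exact: measurable_funB.
- exact: measurable_funB.
- by apply: measurable_funB; exact: measurable_funD.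
- move=> x; apply: le_trans (ler_normD _ _).
  by rewrite (_ : g1 x + g2 x - _ = g1 x - s1 x + (g2 x - s2 x))//; ring.
Qed.

Lemma approximableZ (c : R) g : approximable g -> approximable (fun x => c * g x).
Proof.
move=> [mg H]; split=> [|e e0]; first exact: measurable_funM.
pose C := `|c| `^ a + 1.
have C0 : 0 < C by rewrite ltr_wpDl ?powR_ge0.
have [s ts gs] := H _ (divr_gt0 e0 C0).
have ms := measurable_test_function ts.
exists (fun x => c * s x); first by apply: test_functionM => // k; exact: C_k_cst.
rewrite (eq_integral (fun x : Rn => (`|c| `^ a)%:E * (`|g x - s x| `^ a)%:E)%E); last first.
  by move=> x _; rewrite -mulrBr normrM powRM// EFinM.
rewrite ge0_integralZl_EFin; [|exact: measurableT|..]; last 3 first.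
- by move=> x _; rewrite lee_fin powR_ge0.
- by apply: measurable_powR_norm; exact: measurable_funB.
- exact: powR_ge0.
apply: (@le_trans _ _ ((`|c| `^ a)%:E * (e / C)%:E)%E).
  by apply: lee_wpmul2l; rewrite ?lee_fin ?powR_ge0.
rewrite -EFinM lee_fin mulrCA ler_piMr ?(ltW e0)// ler_pdivrMr// mul1r.
by rewrite lerDl.
Qed.

Lemma approximable0 : approximable (fun=> 0).
Proof.
split=> [|e e0]; first exact: measurable_cst.
exists (fun=> 0); first exact: test_function0.
rewrite (eq_integral (cst 0%E)) ?integral0 ?lee_fin ?(ltW e0)// => x _.
by rewrite subrr normr0 powR0 ?gt_eqF.
Qed.

Lemma approximable_sum (I : Type) (r : seq I) (P : pred I) (F : I -> V -> R) :
  (forall i, P i -> approximable (F i)) ->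
  approximable (fun x => \sum_(i <- r | P i) F i x).
Proof.
move=> AF; elim: r => [|i r IH].
  by under eq_fun do rewrite big_nil; exact: approximable0.
under eq_fun do rewrite big_cons.
have [Pi|_] := boolP (P i); last exact: IH.
by apply: approximableD; [exact: AF|exact: IH].
Qed.

Lemma integral_indic_powR (E : set V) : measurable (E : set Rn) ->
  (\int[mu]_(x in [set: Rn]) (`|\1_E x : R| `^ a)%:E = mu E)%E.
Proof.
move=> mE; transitivity (mu (E `&` setT)); last by rewrite setIT.
rewrite -(integral_indic mu measurableT mE).
apply: eq_integral => x _; rewrite indicE; case: (x \in E).
  by rewrite normr1 powR1.
by rewrite normr0 powR0 ?gt_eqF.
Qed.

(** [smooth_union] converges to the indicator and is dominated by the indicator
    of one large box, by [smooth_union_supp]. *)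
Lemma approximable_boxes (r : seq (V * V)) :
  approximable (\1_(\big[setU/set0]_(ab <- r) box ab)).
Proof.
have mU : measurable ((\big[setU/set0]_(ab <- r) box ab) : set Rn).
  by apply: bigsetU_measurable => ab _; exact: measurable_box.
have [M HM] := smooth_union_supp r.
pose K : set V := box (const_mx (- M) : V, const_mx M).
have mK : measurable (K : set Rn) by exact: measurable_box.
have := @dominated_powR_cvg _ Rn R mu a a1 (fun n => smooth_union n r)
  (\1_(\big[setU/set0]_(ab <- r) box ab)) (\1_K).
move=> /(_ (fun n => measurable_test_function (test_function_smooth_union n r))).
move=> /(_ (measurable_indic mU) (measurable_indic mK)).
have ae_g : {ae mu, forall x, smooth_union n r x @[n --> \oo] -->
    (\1_(\big[setU/set0]_(ab <- r) box ab) x : R)}.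
  by apply: aeW => x; exact: smooth_union_cvg.
move=> /(_ ae_g).
have HK : {ae mu, forall x, forall n, `|smooth_union n r x| <= \1_K x}.
  apply: aeW => x n; have /andP[h0 h1] := smooth_union_itv n r x.
  rewrite ger0_norm// indicE; case: (boolP (x \in K)) => // /negP xK.
  have [->//|/HM Kx] := eqVneq (smooth_union n r x) 0.
  by exfalso; apply: xK; rewrite inE.
move=> /(_ HK); rewrite integral_indic_powR// => /(_ (lebesgue_box_lty _)).
move=> /fine_cvgP[Hfin /cvgr0Pnorm_le Hlim].
split=> [|e e0]; first exact: measurable_indic.
have : \forall n \near \oo, (\int[mu]_(x in [set: Rn])
    (`|\1_(\big[setU/set0]_(ab <- r) box ab) x - smooth_union n r x| `^ a)%:E <= e%:E)%E.
  near=> n.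
  rewrite (eq_integral (fun x : Rn =>
    (`|smooth_union n r x - \1_(\big[setU/set0]_(ab <- r) box ab) x| `^ a)%:E)); last first.
    by move=> x _; rewrite distrC.
  rewrite -[leLHS]fineK; last by near: n.
  rewrite lee_fin; apply: le_trans (ler_norm _) _.
  by near: n; exact: Hlim.
case=> N _ /(_ N (leqnn N)) HN; exists (smooth_union N r) => //.
exact: test_function_smooth_union.
Unshelve. all: by end_near. Qed.

(** By definition of the measure, E is contained in a countable union U of boxes
    with mu (U \ E) <= e, and U is the increasing limit of finite unions. *)
Lemma approximable_indic (E : set V) : measurable (E : set Rn) ->
  (mu E < +oo)%E -> approximable (\1_E).
Proof.
move=> mE Eoo; apply: approximable_lim => [|e e0]; first exact: measurable_indic.
have Efin : mu E \is a fin_num by rewrite ge0_fin_numE// measure_ge0.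
have [_ [B [leB EB] <-] HB] := lb_ereal_inf_adherent e0 Efin.
pose U := \bigcup_k box (B k).
have mU : measurable (U : set Rn).
  by apply: bigcupT_measurable => k; exact: measurable_box.
have muU : (mu U <= mu E + e%:E)%E.
  apply: le_trans (ltW HB); apply: le_trans (outer_measure_sigma_subadditive _ _) _.
  by apply: lee_nneseries => k _ //; exact: lebesgue_box_le.
have Uoo : (mu U < +oo)%E by apply: le_lt_trans muU _; rewrite lte_add_pinfty// ltry.
(* the finite unions increasing to U *)
pose W n : set V := \big[setU/set0]_(ab <- [seq B k | k <- iota 0 n]) box ab.
have WE n x : W n x <-> exists2 k, (k < n)%N & box (B k) x.
  rewrite /W big_map -bigcup_seq; split=> -[k kn xk]; exists k => //.
    by move: kn; rewrite /= mem_iota.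
  by rewrite /= mem_iota.
exists (\1_U).
  apply: (@approximable_cvg (fun n => \1_(W n)) _ (\1_U)).
  - by move=> n; exact: approximable_boxes.
  - exact: measurable_indic.
  - exact: measurable_indic.
  - move=> x; rewrite indicE; have [xU|xU] := boolP (x \in U).
      rewrite inE in xU; case: xU => k _ xk.
      apply: cvg_near_cst; exists k.+1 => // n /= kn; rewrite indicE.
      by rewrite mem_set//; apply/WE; exists k.
    apply: cvg_near_cst; apply: nearW => n; rewrite indicE memNset//.
    by move=> /WE[k _ xk]; move: xU; rewrite notin_setE; apply; exists k.
  - move=> n x; rewrite ger0_norm// !indicE.
    have [/set_mem/WE[k _ xk]|//] := boolP (x \in W n).
    by rewrite mem_set//; exists k.
  - by rewrite integral_indic_powR.
rewrite (eq_integral (fun x : Rn => (`|\1_(U `\` E) x : R| `^ a)%:E)); last first.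
  move=> x _; congr ((_ `^ a)%:E); rewrite distrC !indicE in_setD.
  have [xE|xE] := boolP (x \in E); last by rewrite subr0 andbT.
  suff -> : x \in U by rewrite subrr.
  by rewrite inE; apply: EB; rewrite inE in xE.
rewrite integral_indic_powR; last exact: measurableD.
rewrite measureD//= (_ : U `&` E = E); last by apply/setIidPr.
by rewrite leeBlDr// addeC.
Qed.

End IndicatorDensity.

(** * Density of smooth compactly supported functions in Lebesgue spaces *)

Lemma fimfun_sum (T : Type) (R : realType) (h : {fimfun T >-> R}) :
  exists r : seq R, forall x, h x = \sum_(y <- r) y * \1_(h @^-1` [set y]) x.
Proof. by eexists => x; rewrite {1}fimfunE fsbig_finite. Qed.

Section SmoothDensity.
Context {R : realType} {d : nat}.
Local Notation V := 'rV[R]_d.+1.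
Local Notation Rn := (lebesgueRn R d).
Local Notation mu := (lebesgueRn_measure R d).
Variable a : R.
Hypothesis a1 : 1 <= a.
Implicit Types f : V -> R[i].

Let a0 : 0 < a := lt_le_trans ltr01 a1.

(** Markov's inequality: the level sets of an L^a function away from 0 have
    finite measure. *)
Lemma powR_integral_ge_lty (E : set V) (g : V -> R) (y : R) :
  0 < y -> measurable (E : set Rn) -> measurable_fun [set: Rn] (g : Rn -> R) ->
  (forall x, E x -> y <= g x) ->
  (\int[mu]_(x in [set: Rn]) (`|g x| `^ a)%:E < +oo)%E -> (mu E < +oo)%E.
Proof.
move=> y0 mE mg Eg goo; have ya : 0 < y `^ a by rewrite powR_gt0.
have : ((y `^ a)%:E * mu E < +oo)%E.
  apply: le_lt_trans goo.
  rewrite -(integral_indic_powR a1 mE).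
  rewrite -ge0_integralZl_EFin; [|exact: measurableT|..]; last 3 first.
  - by move=> x _; rewrite lee_fin powR_ge0.
  - by apply: measurable_powR_norm; exact: measurable_indic.
  - exact: ltW.
  apply: le_integralT.
  - by move=> x; rewrite mule_ge0// lee_fin ?powR_ge0// ltW.
  - by apply: measurable_funeM; apply: measurable_powR_norm; exact: measurable_indic.
  - exact: measurable_powR_norm.
  - move=> x; rewrite -EFinM lee_fin indicE; have [/set_mem xE|_] := boolP (x \in E).
      rewrite normr1 powR1 mulr1; have yg := Eg _ xE.
      apply: ge0_ler_powR; rewrite ?nnegrE ?(ltW a0) ?(ltW y0)//.
      exact: le_trans (ler_norm _).
    by rewrite normr0 powR0 ?mulr0 ?powR_ge0// gt_eqF.
case: (mu E) (measure_ge0 mu E) => [r||] // _; first by move=> _; rewrite ltry.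
by rewrite gt0_muley ?lte_fin.
Qed.

(** Increasing limit of simple functions, whose nonzero levels have finite
    measure by [powR_integral_ge_lty]. *)
Lemma approximable_nonneg (g : V -> R) :
  measurable_fun [set: Rn] (g : Rn -> R) -> (forall x, 0 <= g x) ->
  (\int[mu]_(x in [set: Rn]) (`|g x| `^ a)%:E < +oo)%E -> approximable a g.
Proof.
move=> mg g0 goo.
have mEg : measurable_fun [set: Rn] ((EFin \o g) : Rn -> \bar R) by exact/measurable_EFinP.
pose h n := nnsfun_approx measurableT mEg n.
have h_g (x : Rn) : h n x @[n --> \oo] --> g x.
  have := @cvg_nnsfun_approx _ Rn R setT measurableT _ mEg _ x I.
  move=> H; have /fine_cvg := H (fun y _ => g0 y).
  exact.
have h_le n (x : Rn) : h n x <= g x.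
  have nd : {homo (fun m => h m x) : m k / (m <= k)%N >-> m <= k}.
    by move=> m k mk; have /lefP/(_ x) := nd_nnsfun_approx measurableT mEg mk.
  have := nondecreasing_cvgn_le nd (cvgP _ (h_g x)) n.
  by rewrite (cvg_lim (@Rhausdorff R) (h_g x)).
have h_ge0 n (x : Rn) : 0 <= h n x by [].
apply: (approximable_cvg a1 (g_ := fun n => h n) (G := g)) => //; last first.
  by move=> n x; rewrite ger0_norm//.
move=> n.
have [r hE] := fimfun_sum (h n).
have -> : (h n : V -> R) =
    fun x => \sum_(y <- r | true) y * \1_(h n @^-1` [set y]) x.
  by apply/funext => x; exact: hE.
have Hy (y : R) : approximable a (fun x : V => y * \1_(h n @^-1` [set y]) x).
  have [y0|y0] := leP y 0.
    have -> : (fun x : V => y * \1_(h n @^-1` [set y]) x) = fun=> 0.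
      apply/funext => x; rewrite indicE.
      have [/set_mem /= hy|_] := boolP (x \in _); last by rewrite mulr0.
      by rewrite mulr1; apply/eqP; rewrite eq_le y0 -hy h_ge0.
    exact: approximable0.
  apply: approximableZ => //.
  have mE : measurable (h n @^-1` [set y] : set Rn) by exact: measurable_funPTI.
  apply: approximable_indic => //.
  apply: (@powR_integral_ge_lty _ g y) => //.
  by move=> x /= <-; exact: h_le.
by apply: (approximable_sum a1) => y _; exact: Hy.
Qed.

Lemma approximable_Lp (g : V -> R) :
  measurable_fun [set: Rn] (g : Rn -> R) ->
  (\int[mu]_(x in [set: Rn]) (`|g x| `^ a)%:E < +oo)%E -> approximable a g.
Proof.
move=> mg goo.
have H (g' : V -> R) : measurable_fun [set: Rn] (g' : Rn -> R) ->
    (forall x, 0 <= g' x <= `|g x|) -> approximable a g'.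
  move=> mg' g'g; apply: approximable_nonneg; first exact: mg'.
    by move=> x; have /andP[] := g'g x.
  apply: le_lt_trans goo; apply: le_integralT.
  - by move=> x; rewrite lee_fin powR_ge0.
  - exact: measurable_powR_norm.
  - exact: measurable_powR_norm.
  - move=> x; rewrite lee_fin; have /andP[g0 gg] := g'g x.
    by apply: ge0_ler_powR; rewrite ?nnegrE ?(ltW a0)// ger0_norm.
have -> : g = fun x => Num.max (g x) 0 + (-1) * Num.max (- g x) 0.
  apply/funext => x; have [|] := leP (g x) 0; have [|] := leP (- g x) 0; lra.
apply: (approximableD a1).
  apply: H; first by apply: measurable_maxr; [exact: mg|exact: measurable_cst].
  by move=> x; rewrite le_max lexx orbT ge_max ler_norm normr_ge0.
apply: approximableZ; apply: H.
  apply: measurable_maxr; last exact: measurable_cst.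
  exact: measurableT_comp.
by move=> x; rewrite le_max lexx orbT ge_max -normrN ler_norm normr_ge0.
Qed.

Lemma compact_support_closure (A : set V) (M : R) :
  A `<=` box (const_mx (- M), const_mx M) -> compact (closure A).
Proof.
move=> AM.
have cK : compact [set v : V | forall i, `[- M, M]%classic (v ord0 i)].
  by apply: (@rV_compact _ _ (fun=> `[- M, M]%classic)) => i; exact: segment_compact.
apply: (subclosed_compact _ cK); first exact: closed_closure.
rewrite [X in _ `<=` X](_ : _ = closure
    [set v : V | forall i, `[- M, M]%classic (v ord0 i)]).
  apply: closureS => x /AM xM i.
  by have := xM i; rewrite !mxE /= in_itv/= => /andP[-> /ltW ->].
by apply/closure_id; apply: compact_closed.
Qed.

(** Real and imaginary parts are approximated separately. *)
Lemma smooth_compact_dense f (e : R) : 0 < e -> measurable_C f ->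
  (\int[mu]_(x in [set: Rn]) (modulus (f x) `^ a)%:E < +oo)%E ->
  exists2 s, smooth_compact s &
    (\int[mu]_(x in [set: Rn]) (modulus (f x - s x) `^ a)%:E <= e%:E)%E.
Proof.
move=> e0 mf foo; have [mf1 mf2] := mf.
have le_foo (g : V -> R) : measurable_fun [set: Rn] (g : Rn -> R) ->
    (forall x, `|g x| <= modulus (f x)) -> approximable a g.
  move=> mg gf; apply: approximable_Lp; first exact: mg.
  apply: le_lt_trans foo; apply: le_integralT.
  - by move=> x; rewrite lee_fin powR_ge0.
  - exact: measurable_powR_norm.
  - exact: measurable_modulus_powR.
  - by move=> x; rewrite lee_fin ge0_ler_powR ?nnegrE ?modulus_ge0// ltW.
have [_ A1] : approximable a (@complex.Re R \o f).
  apply: le_foo => // x /=; rewrite modulusE -sqrtr_sqr ler_wsqrtr//.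
  by rewrite lerDl sqr_ge0.
have [_ A2] : approximable a (@complex.Im R \o f).
  apply: le_foo => // x /=; rewrite modulusE -sqrtr_sqr ler_wsqrtr//.
  by rewrite lerDr sqr_ge0.
have [e' e'0 He] := half_budget a e0.
have [s1 [C1 [M1 S1]] H1] := A1 _ e'0; have [s2 [C2 [M2 S2]] H2] := A2 _ e'0.
have ms1 : measurable_fun [set: Rn] (s1 : Rn -> R).
  exact: continuous_measurableRn (C_k_continuous (C1 0%N)).
have ms2 : measurable_fun [set: Rn] (s2 : Rn -> R).
  exact: continuous_measurableRn (C_k_continuous (C2 0%N)).
pose s (x : V) : R[i] := (s1 x +i* s2 x)%C.
have mfs : measurable_C (fun x => f x - s x).
  by apply: measurable_CB => //; split.
exists s.
  split; first by move=> k; split.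
  apply: (@compact_support_closure _ (Num.max M1 M2)) => x /= sx.
  have [s10|s10] := eqVneq (s1 x) 0; last first.
    by apply: (box_sub _ (S1 _ s10)); rewrite le_max lexx.
  have [s20|s20] := eqVneq (s2 x) 0; last first.
    by apply: (box_sub _ (S2 _ s20)); rewrite le_max lexx orbT.
  by move: sx; rewrite /s s10 s20 eqxx.
apply: le_trans (He _ _ H1 H2).
rewrite (eq_integral (fun x : Rn => (`|modulus (f x - s x)| `^ a)%:E)); last first.
  by move=> x _; rewrite ger0_norm ?modulus_ge0.
apply: (@integral_powRD_le _ Rn R mu a a1
  (fun x : Rn => complex.Re (f x) - s1 x) (fun x : Rn => complex.Im (f x) - s2 x)
  (fun x : Rn => modulus (f x - s x))).
- exact: measurable_funB.
- exact: measurable_funB.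
- exact: measurable_modulus.
- move=> x; rewrite ger0_norm ?modulus_ge0//; apply: le_trans (modulus_le _) _.
  by rewrite /s; case: (f x).
Qed.

Lemma smooth_compact_Lp f : smooth_compact f -> measurable_C f /\
  (\int[mu]_(x in [set: Rn]) (modulus (f x) `^ a)%:E < +oo)%E.
Proof.
move=> [Cf cK]; set K := closure _ in cK.
have [[c1 _] [c2 _]] := Cf 0%N.
have mf : measurable_C f by split; exact: continuous_measurableRn.
split=> //.
have bnd (g : V -> R) : continuous g -> exists M, forall x, K x -> `|g x| <= M.
  move=> cg.
  have /compact_bounded[M [_ HM]] : compact (g @` K).
    by apply: continuous_compact => //; exact: continuous_subspaceT.
  exists (M + 1) => x Kx; apply: (HM (M + 1)); first by rewrite ltrDl.
  by exists x.
have [B1 HB1] := bnd _ c1; have [B2 HB2] := bnd _ c2.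
pose C := `|B1| + `|B2|.
have mK : measurable (K : set Rn) by exact: compact_measurableRn.
apply: (@le_lt_trans _ _ (\int[mu]_(x in [set: Rn])
    ((C `^ a)%:E * (`|\1_K x : R| `^ a)%:E))%E).
  apply: le_integralT.
  - by move=> x; rewrite lee_fin powR_ge0.
  - exact: measurable_modulus_powR.
  - by apply: measurable_funeM; apply: measurable_powR_norm; exact: measurable_indic.
  - move=> x; rewrite -EFinM lee_fin indicE; have [/set_mem Kx|nKx] := boolP (x \in K).
      rewrite normr1 powR1 mulr1 ge0_ler_powR ?nnegrE ?modulus_ge0 ?addr_ge0 ?(ltW a0)//.
      apply: le_trans (modulus_le _) _; apply: lerD.
        by apply: le_trans (HB1 _ Kx) _; exact: ler_norm.
      by apply: le_trans (HB2 _ Kx) _; exact: ler_norm.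
    have [fx0|fx0] := eqVneq (f x) 0.
      by rewrite fx0 modulus0 powR0 ?gt_eqF// mulr_ge0 ?powR_ge0.
    by move: nKx; rewrite notin_setE; case; exact: subset_closure.
rewrite ge0_integralZl_EFin; [|exact: measurableT|..]; last 3 first.
- by move=> x _; rewrite lee_fin powR_ge0.
- by apply: measurable_powR_norm; exact: measurable_indic.
- exact: powR_ge0.
rewrite integral_indic_powR// lte_mul_pinfty ?lee_fin ?powR_ge0//.
exact: lebesgue_compact_lty.
Qed.

End SmoothDensity.

(** * Absolutely continuous norms and closures *)

Lemma Lebesgue_spaceP (R : realType) (d : nat) (alpha : R)
    (f : 'rV[R]_d.+1 -> R[i]) :
  1 <= alpha -> Lebesgue_space alpha f <-> measurable_C f /\
  (\int[lebesgueRn_measure R d]_(x in [set: lebesgueRn R d])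
     (modulus (f x) `^ alpha)%:E < +oo)%E.
Proof.
move=> alpha1; have alpha0 : 0 < alpha by exact: lt_le_trans alpha1.
have E : (\int[lebesgueRn_measure R d]_(x in [set: lebesgueRn R d])
      (`|(modulus (f x))%:E| `^ alpha) =
    \int[lebesgueRn_measure R d]_(x in [set: lebesgueRn R d])
      (modulus (f x) `^ alpha)%:E)%E.
  by apply: eq_integral => x _; rewrite gee0_abs ?lee_fin ?modulus_ge0.
rewrite /Lebesgue_space /= unlock E; split=> -[mf Hf]; split; try exact: mf.
  by apply: (lty_poweRy _ Hf); rewrite invr_neq0// gt_eqF.
exact: poweR_lty.
Qed.

Section AbsolutelyContinuousNorm.
Context {R : realType} {d : nat}.
Local Notation V := 'rV[R]_d.+1.
Local Notation Rn := (lebesgueRn R d).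
Local Notation mu := (lebesgueRn_measure R d).
Variables (p : V -> \bar R) (alpha : R) (q : \bar R).
Hypothesis mp : measurable_fun [set: Rn] (p : Rn -> \bar R).
Hypothesis p1 : forall x, (1 <= p x)%E.
Hypothesis palpha : {ae mu, forall x, (p x <= alpha%:E)%E}.
Hypothesis alphaq : (alpha%:E <= q)%E.
Implicit Types f g h : V -> R[i].

Let alpha1 : 1 <= alpha := alpha_ge1 p1 palpha.
Let alpha0 : 0 < alpha := lt_le_trans ltr01 alpha1.

Let quasi_triangle f g h c :=
  @fofana_norm_quasi_triangle R d p alpha q mp p1 palpha alphaq f g h c.
Let norm_le_integral h A :=
  @fofana_norm_le_integral R d p alpha q mp p1 palpha alphaq h A.

Lemma fofana_norm_ge0 f : (0 <= fofana_norm p q alpha f)%E.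
Proof.
apply: (@le_trans _ _ (amalgam_norm p q (dilation alpha 1 f))); last first.
  by apply: ereal_sup_ubound; exists 1 => //=.
rewrite /amalgam_norm /lq_norm; case: q => [r||]; first exact: poweR_ge0.
  apply: (@le_trans _ _ `|var_norm p (cut (dilation alpha 1 f) (cube 1 0))|%E) => //.
  by apply: ereal_sup_ubound; exists 0.
apply: (@le_trans _ _ `|var_norm p (cut (dilation alpha 1 f) (cube 1 0))|%E) => //.
by apply: ereal_sup_ubound; exists 0.
Qed.

Lemma integral_powR_bound f :
  (\int[mu]_(x in [set: Rn]) (modulus (f x) `^ alpha)%:E < +oo)%E ->
  exists2 A : R, 0 < A &
    (\int[mu]_(x in [set: Rn]) (modulus (f x) `^ alpha)%:E <=
     (A `^ alpha)%:E)%E.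
Proof.
set S := (\int[mu]_(x in _) _)%E => Soo.
have S0 : (0 <= S)%E by apply: integral_ge0 => x _; rewrite lee_fin powR_ge0.
have Sfin : S \is a fin_num by rewrite ge0_fin_numE.
have s0 : 0 <= fine S by exact: fine_ge0.
exists ((fine S + 1) `^ alpha^-1); first by rewrite powR_gt0// ltr_wpDl.
rewrite -powRrM mulVf ?gt_eqF// powRr1 ?addr_ge0//.
by rewrite -(fineK Sfin) lee_fin lerDl.
Qed.

(** The global norm is handled by [fofana_norm_le_integral]. For a compact K,
    [var_norm_cut_le] applies since mu K is finite. *)
Lemma Lebesgue_space_fofana f : Lebesgue_space alpha f -> fofana p q alpha f.
Proof.
move=> /(Lebesgue_spaceP _ alpha1)[mf foo]; split; last first.
  have [A A0 HA] := integral_powR_bound foo.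
  exact: le_lt_trans (norm_le_integral A0 mf HA) (ltry _).
split; [done|move=> K cK].
have mK : measurable (K : set Rn) by exact: compact_measurableRn.
split; first exact: measurable_C_cut.
have mc : measurable_C (cut f K) by exact: measurable_C_cut.
have I0 : (0 <= \int[mu]_(x in [set: Rn]) ((modulus (cut f K x) / 1) `^ alpha)%:E)%E.
  by apply: integral_ge0 => x _; rewrite lee_fin powR_ge0.
have Ioo : (\int[mu]_(x in [set: Rn]) ((modulus (cut f K x) / 1) `^ alpha)%:E < +oo)%E.
  apply: le_lt_trans foo; apply: le_integralT.
  - by move=> x; rewrite lee_fin powR_ge0.
  - apply/measurable_EFinP; apply: measurable_powR_fun; last exact: measurable_cst.
    by apply: measurable_funM; [exact: measurable_modulus|exact: measurable_cst].
  - exact: measurable_modulus_powR.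
  - move=> x; rewrite lee_fin divr1 /cut; case: ifP => // _.
    by rewrite modulus0 powR0 ?powR_ge0// gt_eqF.
have Koo : (mu K < +oo)%E by exact: lebesgue_compact_lty.
have K0 : (0 <= mu K)%E by exact: measure_ge0.
pose I := (\int[mu]_(x in [set: Rn]) ((modulus (cut f K x) / 1) `^ alpha)%:E)%E.
apply: le_lt_trans (ltry (1 + fine (mu K) + fine I)).
rewrite -[X in (_ <= X%:E)%E]mulr1.
apply: (var_norm_cut_le mp p1 palpha) => //.
  by rewrite -addrA lerDl addr_ge0// fine_ge0.
rewrite !EFinD !fineK ?ge0_fin_numE// leeD2r// -[leLHS]add0e.
by apply: leeD => //; rewrite lee_fin.
Qed.

Lemma lty_real_bound (x : \bar R) : (x < +oo)%E ->
  exists2 c : R, 0 <= c & (x <= c%:E)%E.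
Proof.
case: x => [r||]// _; last by exists 0; rewrite ?leNye.
by exists `|r| => //; rewrite lee_fin ler_norm.
Qed.

(** The quasi-triangle inequalities applied to |h| <= |f| + |f|. *)
Lemma fofana_dominated f h : fofana p q alpha f -> measurable_C h ->
  {ae mu, forall x, modulus (h x) <= modulus (f x)} -> fofana p q alpha h.
Proof.
move=> [[mf floc] foo] mh hf.
have [c c0 fc] := lty_real_bound foo.
have hff : {ae mu, forall x, modulus (h x) <= modulus (f x) + modulus (f x)}.
  by apply: filterS hf => x /le_trans; apply; rewrite lerDl modulus_ge0.
split; last exact: le_lt_trans (quasi_triangle c0 mf mf mh hff fc fc) (ltry _).
split; [done|move=> K cK].
have mK : measurable (K : set Rn) by exact: compact_measurableRn.
have [mfK fKoo] := floc K cK.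
split; first exact: measurable_C_cut.
have mhK : measurable_C (cut h K) by exact: measurable_C_cut.
apply: le_lt_trans (var_norm_quasi_triangle mp p1 palpha mfK mfK mhK _) _.
  apply: filterS hff => x hx; rewrite /cut; case: ifP => // _.
  by rewrite modulus0 addr0.
by rewrite maxxx lte_mul_pinfty// lee_fin.
Qed.

Lemma cvg_fofana_norm0 (u : nat -> V -> R[i]) :
  (forall e : R, 0 < e ->
    \forall n \near \oo, (fofana_norm p q alpha (u n) <= e%:E)%E) ->
  fofana_norm p q alpha (u n) @[n --> \oo] --> 0%E.
Proof.
move=> H.
have fin n (e : R) : (fofana_norm p q alpha (u n) <= e%:E)%E ->
    fofana_norm p q alpha (u n) \is a fin_num.
  by move=> ue; rewrite ge0_fin_numE ?fofana_norm_ge0// (le_lt_trans ue)// ltry.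
apply/fine_cvgP; split.
  by apply: filterS (H 1 ltr01) => n; exact: fin.
apply/cvgr0Pnorm_le => e e0; apply: filterS (H e e0) => n un /=.
rewrite ger0_norm; last by rewrite fine_ge0// fofana_norm_ge0.
by rewrite -lee_fin fineK// (fin n e).
Qed.

(** In the order of the complex numbers, u_n <= |b| forces u_n to be real; a
    nonincreasing real sequence tending to 0 is nonnegative, hence
    |u_n| = u_n <= |b|. *)
Lemma decreasing_to_zero_ge0 (u : nat -> R[i]) (b : R[i]) :
  (forall n, u n.+1 <= u n <= `|b|) -> modulus (u n) @[n --> \oo] --> (0 : R) ->
  forall n, modulus (u n) <= modulus b.
Proof.
move=> ub u0.
have Im_u n : complex.Im (u n) = 0.
  have /andP[_] := ub n; rewrite -modulusC lecE /= => /andP[/eqP-> _].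
  by [].
have dec n m : (n <= m)%N -> complex.Re (u m) <= complex.Re (u n).
  move=> /subnK <-; elim: (m - n)%N => [|k IH]; first by rewrite add0n.
  apply: le_trans IH; rewrite addSn.
  by have /andP[+ _] := ub (k + n)%N; rewrite lecE => /andP[].
have mod_u n : modulus (u n) = `|complex.Re (u n)|.
  by rewrite modulusE Im_u expr0n/= addr0 sqrtr_sqr.
have u_ge0 n : 0 <= complex.Re (u n).
  rewrite leNgt; apply/negP => un.
  move/cvgr0Pnorm_lt : u0 => /(_ (- complex.Re (u n))); rewrite oppr_gt0 => /(_ un).
  case=> N _ /(_ (maxn N n) (leq_maxl _ _)); rewrite /= mod_u normr_id.
  have := dec _ _ (leq_maxr N n) => unm.
  by rewrite ler0_norm ?(le_trans unm) ?(ltW un)// ltrN2 ltNge unm.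
move=> n; rewrite mod_u ger0_norm//.
by have /andP[_] := ub n; rewrite -modulusC lecE /= => /andP[].
Qed.

(** For g in L^alpha close to f, |f_n| <= h_n + |f - g| with
    h_n = min (|f_n|, |g|), and h_n tends to 0 in L^alpha by domination. *)
Lemma closure_Lebesgue_space_abs_cont :
  fofana_closure p q alpha (Lebesgue_space alpha) `<=`
  fofana_abs_cont p q alpha.
Proof.
move=> f [Ff Hf]; split=> // f_ Ff_ decf_ f_0; apply: cvg_fofana_norm0 => e e0.
have e8 : 0 < e / 8 by rewrite divr_gt0.
have [g Lg fg] := Hf _ e8; have /(Lebesgue_spaceP _ alpha1)[mg goo] := Lg.
have mf : measurable_C f by case: Ff => -[].
have mf_ n : measurable_C (f_ n) by case: (Ff_ n) => -[].
have f_f : {ae mu, forall x, forall n, modulus (f_ n x) <= modulus (f x)}.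
  have : {ae mu, forall x, forall n, f_ n.+1 x <= f_ n x <= `|f x|}.
    exact: ae_foralln.
  apply: filterS2 f_0 => x f_x0 decx n.
  exact: (@decreasing_to_zero_ge0 (fun n => f_ n x)).
pose h n (x : V) : R := Num.min (modulus (f_ n x)) (modulus (g x)).
have h0 n x : 0 <= h n x by rewrite le_min !modulus_ge0.
have mh n : measurable_fun [set: Rn] (h n : Rn -> R).
  by apply: measurable_minr; exact: measurable_modulus.
have cvgh : {ae mu, forall x, h n x @[n --> \oo] --> (cst 0 x : R)}.
  apply: filterS f_0 => x f_x0.
  apply: (squeeze_cvgr _ (cvg_cst (0 : R)) f_x0).
  by apply: nearW => n; rewrite h0/= ge_min lexx.
have hg : {ae mu, forall x, forall n, `|h n x| <= modulus (g x)}.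
  by apply: aeW => x n; rewrite ger0_norm// ge_min lexx orbT.
have goo' : (\int[mu]_(x in [set: Rn]) (`|modulus (g x)| `^ alpha)%:E < +oo)%E.
  rewrite (eq_integral (fun x : Rn => (modulus (g x) `^ alpha)%:E))// => x _.
  by rewrite ger0_norm// modulus_ge0.
have /fine_cvgP[Hfin /cvgr0Pnorm_le Hlim] := @dominated_powR_cvg _ Rn R mu alpha
  alpha1 h (cst 0) (fun x => modulus (g x)) mh (@measurable_cst _ _ _ _ _ (0 : R))
  (measurable_modulus mg) cvgh hg goo'.
have e16 : 0 < e / 16 by rewrite divr_gt0.
have e16a : 0 < (e / 16) `^ alpha by rewrite powR_gt0.
near=> n.
have hn : (fofana_norm p q alpha (fun x => (h n x)%:C%C) <= (e / 8)%:E)%E.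
  rewrite (_ : e / 8 = 2 * (e / 16)); last by field.
  apply: norm_le_integral; [exact: e16|exact: measurable_C_real|].
  rewrite (eq_integral (fun x : Rn => (`|h n x - cst 0 x| `^ alpha)%:E)); last first.
    by move=> x _; rewrite modulus_real subr0.
  rewrite -[leLHS]fineK; last by near: n.
  rewrite lee_fin; apply: le_trans (ler_norm _) _.
  by near: n; exact: Hlim.
rewrite (_ : e = 8 * (e / 8)); last by field.
apply: (quasi_triangle _ _ _ _ _ hn (ltW fg)).
- exact: ltW.
- exact: measurable_C_real.
- exact: measurable_CB.
- exact: mf_.
apply: filterS f_f => x /(_ n) fnx; rewrite modulus_real ger0_norm// /h.
have [_|_] := leP (modulus (f_ n x)) (modulus (g x)).
  by rewrite lerDl modulus_ge0.
apply: le_trans fnx _; apply: le_trans (modulusD _ _).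
by rewrite /= addrC subrK.
Unshelve. all: by end_near. Qed.

(** Absolute continuity is applied to |f| cut off to the complement of G n, a
    bounded set on which f is bounded; the sets G n increase to the whole
    space. *)
Lemma abs_cont_closure_smooth_compact :
  fofana_abs_cont p q alpha `<=` fofana_closure p q alpha smooth_compact.
Proof.
move=> f [Ff Hf]; split=> // e e0.
have mf : measurable_C f by case: Ff => -[].
pose G (n : nat) : set V := box (const_mx (- n%:R) : V, const_mx n%:R) `&`
  [set x | modulus (f x) <= n%:R].
have mG n : measurable (G n : set Rn).
  apply: measurableI; first exact: measurable_box.
  rewrite (_ : [set x | _] = (fun x => modulus (f x)) @^-1` `]-oo, n%:R]); last first.
    by apply/seteqP; split=> x /=; rewrite in_itv.
  by rewrite -[X in measurable X]setTI; exact: (measurable_modulus mf).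
have Gincr n : G n `<=` G n.+1.
  move=> x [Gx fx]; split; first by apply: (box_sub _ Gx); rewrite ler_nat.
  by apply: le_trans fx _; rewrite ler_nat.
have Gall x : \forall n \near \oo, G n x.
  pose M := \big[Num.max/modulus (f x)]_i `|x ord0 i|.
  near=> n; have Mn : M < n%:R by near: n; exact: nbhs_infty_gtr.
  split; last first.
    by apply: ltW; apply: le_lt_trans Mn; exact: bigmax_ge_id.
  move=> i; rewrite !mxE.
  have := le_bigmax (modulus (f x)) (fun i => `|x ord0 i|) i.
  by move=> /le_lt_trans /(_ Mn); rewrite ltr_norml => /andP[/ltW -> ->].
pose f_ (n : nat) := cut (fun x => `|f x|) (~` G n).
have f_E n x : f_ n x = if x \in G n then 0 else `|f x|.
  by rewrite /f_ /cut in_setC; case: (x \in G n).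
have mf_ n : measurable_C (f_ n).
  apply: measurable_C_cut; first exact: measurableC.
  have -> : (fun x : V => `|f x|) = (fun x : V => (modulus (f x))%:C%C).
    by apply/funext => x; rewrite modulusC.
  exact: measurable_C_real (measurable_modulus mf).
have f_lim : fofana_norm p q alpha (f_ n) @[n --> \oo] --> 0%E.
  apply: Hf.
  - move=> n; apply: (fofana_dominated Ff) => //; apply: aeW => x.
    by rewrite f_E; case: ifP => _; rewrite ?modulus0 ?modulus_ge0// modulus_id.
  - move=> n; apply: aeW => x; rewrite !f_E.
    have [/set_mem/Gincr/mem_set ->|_] := boolP (x \in G n).
      by rewrite lexx normr_ge0.
    by rewrite lexx andbT; case: ifP => // _; rewrite normr_ge0.
  - apply: aeW => x; apply: cvg_near_cst; apply: filterS (Gall x) => n Gnx.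
    by rewrite f_E mem_set// modulus0.
have e16 : 0 < e / 16 by rewrite divr_gt0.
have e32 : 0 < e / 32 by rewrite divr_gt0.
have [n fn] : exists n, (fofana_norm p q alpha (f_ n) <= (e / 16)%:E)%E.
  move/fine_cvgP : f_lim => [[N1 _ H1] /cvgr0Pnorm_le /(_ _ e16)[N2 _ H2]].
  exists (maxn N1 N2); have := H2 _ (leq_maxr N1 N2); have := H1 _ (leq_maxl N1 N2).
  by move=> /= /fineK <- /(le_trans (ler_norm _)); rewrite lee_fin.
pose g := cut f (G n).
have mg : measurable_C g by exact: measurable_C_cut.
have goo : (\int[mu]_(x in [set: Rn]) (modulus (g x) `^ alpha)%:E < +oo)%E.
  apply: (@le_lt_trans _ _ (\int[mu]_(x in [set: Rn])
      ((n%:R `^ alpha)%:E * (`|\1_(G n) x : R| `^ alpha)%:E))%E).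
    apply: le_integralT.
    - by move=> x; rewrite lee_fin powR_ge0.
    - exact: measurable_modulus_powR.
    - by apply: measurable_funeM; apply: measurable_powR_norm; exact: measurable_indic.
    - move=> x; rewrite -EFinM lee_fin indicE /g /cut.
      have [/set_mem[_ fx]|_] := boolP (x \in G n).
        by rewrite normr1 powR1 mulr1 ge0_ler_powR ?nnegrE ?modulus_ge0// ltW.
      by rewrite modulus0 powR0 ?gt_eqF// mulr_ge0 ?powR_ge0.
  rewrite ge0_integralZl_EFin; [|exact: measurableT|..]; last 3 first.
  - by move=> x _; rewrite lee_fin powR_ge0.
  - by apply: measurable_powR_norm; exact: measurable_indic.
  - exact: powR_ge0.
  rewrite integral_indic_powR// lte_mul_pinfty ?lee_fin ?powR_ge0//.
  apply: le_lt_trans (lebesgue_box_lty (const_mx (- n%:R) : V, const_mx n%:R)).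
  by apply: lebesgue_outer_le => x [].
have e32a : 0 < (e / 32) `^ alpha by rewrite powR_gt0.
have [s ss gs] := smooth_compact_dense alpha1 e32a mg goo.
have [ms _] := smooth_compact_Lp alpha1 ss.
exists s => //; apply: (@le_lt_trans _ _ (8 * (e / 16))%:E); last by rewrite lte_fin; lra.
apply: (@quasi_triangle (f_ n) (g \- s) _ _ (ltW e16)).
- exact: mf_.
- exact: measurable_CB.
- exact: measurable_CB.
- apply: aeW => x; rewrite f_E /g /= /cut; have [_|_] := boolP (x \in G n).
    by rewrite lerDr modulus_ge0.
  by rewrite modulus_id sub0r; exact: modulusD.
- exact: fn.
- rewrite (_ : e / 16 = 2 * (e / 32)); last by field.
  by apply: norm_le_integral; [exact: e32|exact: measurable_CB|exact: gs].
Unshelve. all: by end_near. Qed.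

End AbsolutelyContinuousNorm.

Theorem theorem3p3 (R : realType) (d : nat) (p : 'rV[R]_d.+1 -> \bar R)
    (alpha : R) (q : \bar R) (hp : variable_exponent p)
    (hpalpha : {ae lebesgueRn_measure R d, forall x, (p x <= alpha%:E)%E})
    (hq : (alpha%:E <= q)%E) :
  [/\ smooth_compact `<=` fofana p q alpha,
      Lebesgue_space alpha `<=` fofana p q alpha,
      fofana_abs_cont p q alpha = fofana_closure p q alpha smooth_compact &
      fofana_abs_cont p q alpha =
        fofana_closure p q alpha (Lebesgue_space alpha)].
Proof.
have [mp p1 _ _] := hp; have alpha1 := alpha_ge1 p1 hpalpha.
have smooth_Lebesgue : @smooth_compact R d `<=` Lebesgue_space alpha.
  move=> f sf; apply/(Lebesgue_spaceP _ alpha1).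
  exact: smooth_compact_Lp alpha1 _ sf.
have Lebesgue_fofana : Lebesgue_space alpha `<=` fofana p q alpha.
  by move=> f; exact: Lebesgue_space_fofana.
have closure_sub : fofana_closure p q alpha smooth_compact `<=`
    fofana_closure p q alpha (Lebesgue_space alpha).
  move=> f [Ff Hf]; split=> // e /Hf[g gs fg].
  by exists g; [exact: smooth_Lebesgue|exact: fg].
have abs_smooth := abs_cont_closure_smooth_compact mp p1 hpalpha hq.
have Lebesgue_abs := closure_Lebesgue_space_abs_cont mp p1 hpalpha hq.
split.
- by move=> f /smooth_Lebesgue; exact: Lebesgue_fofana.
- exact: Lebesgue_fofana.
- by apply/seteqP; split=> [|f /closure_sub]; [exact: abs_smooth|exact: Lebesgue_abs].
- by apply/seteqP; split=> [f /abs_smooth|]; [exact: closure_sub|exact: Lebesgue_abs].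
Qed.
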